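(* Let $a,b\ge 1$ be integers, not both equal to $1$. Then the clock graph $\theta_{ab2}$ is $e$-positive, i.e., in the expansion of its chromatic symmetric function $X_{\theta_{ab2}}$ in the basis $\{e_\lambda\}$ of elementary symmetric functions, every coefficient is nonnegative.
   Context: For a finite simple graph $G$, its chromatic symmetric function is $X_G=\sum_{\kappa}\prod_{v\in V(G)}x_{\kappa(v)}$, the sum over all proper colorings $\kappa\colon V(G)\to\{1,2,\dots\}$. Here $e_k=\sum_{1\le j_1<\dots<j_k}x_{j_1}\cdots x_{j_k}$ and $e_\lambda=e_{\lambda_1}e_{\lambda_2}\cdots$ for a partition $\lambda$. For positive integers $a,b,c$ (at most one of which equals $1$), the theta graph $\theta_{abc}$ is the simple graph formed by two distinct vertices $u,v$ joined by three internally disjoint paths of lengths (numbers of edges) $a$, $b$ and $c$; it has $a+b+c-1$ vertices. The graphs $\theta_{ab2}$ are called clock graphs. *)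

(* Defs.v *)
From HB Require Import structures.
From mathcomp Require Import all_boot all_order all_algebra finmap.
From mathcomp Require Import monalg.
From mathcomp Require Import boolp classical_sets functions cardinality fsbigop.

Set Implicit Arguments.
Unset Strict Implicit.
Unset Printing Implicit Defensive.

Import Order.TTheory GRing.Theory Num.Theory.
Local Open Scope classical_set_scope.
Local Open Scope ring_scope.

Record sgraph := SGraph {
  vertex : finType;
  adj : rel vertex;
  adj_sym : symmetric adj;
  adj_irr : irreflexive adj }.

(* Monomials in the variables x_0, x_1, ...; the colours and variables are    *)
(* indexed by nat starting from 0 instead of 1.                               *)
Definition monomial : choiceType := {cmonom nat}.

Definition monomial_prod (I : Type) (s : seq I) (j : I -> nat) : monomial :=
  \big[mmul/mone]_(i <- s) ucm (j i).

(* Formal power series in countably many variables, f m being the coefficient *)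
(* of the monomial m. In the sums \sum_(i \in A) below only finitely many     *)
(* terms are nonzero; see the finiteness lemmas at the end of this file.      *)
Definition series := monomial -> int.

Definition series1 : series := fun m => (m == mone)%:R.

Definition series_mul (f g : series) : series := fun m =>
  \sum_(p \in [set p : monomial * monomial | mmul p.1 p.2 = m]) f p.1 * g p.2.

(* k-subsets of nat stand for index sequences j_1 < ... < j_k. *)
Definition elementary (k : nat) : series := fun m =>
  \sum_(S \in [set S : {fset nat} | #|` S|%fset = k])
    ((monomial_prod (enum_fset S) id == m)%:R : int).

Record int_partition := IntPartition {
  parts :> seq nat;
  partsP : sorted geq parts && all (leq 1) parts }.

HB.instance Definition _ := [isSub for parts].
HB.instance Definition _ := [Choice of int_partition by <:].

Definition elementary_part (la : int_partition) : series :=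
  foldr series_mul series1 [seq elementary k | k <- parts la].

Definition proper_coloring (G : sgraph) (kappa : {ffun vertex G -> nat}) : Prop :=
  forall x y : vertex G, adj x y -> kappa x <> kappa y.

Definition chromatic_symmetric (G : sgraph) : series := fun m =>
  \sum_(kappa \in [set kappa | @proper_coloring G kappa])
    ((monomial_prod (enum (vertex G)) kappa == m)%:R : int).

(* c is the (finitely supported) family of coefficients of f in the basis of  *)
(* the e_la.                                                                  *)
Definition e_expansion (f : series) (c : {fsfun int_partition -> int with 0}) : Prop :=
  forall m : monomial,
    f m = \sum_(la <- enum_fset (finsupp c)) c la * elementary_part la m.

Definition e_positive (G : sgraph) : Prop :=
  exists2 c : {fsfun int_partition -> int with 0},
    e_expansion (chromatic_symmetric G) c & forall la : int_partition, 0 <= c la.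

Section Theta.
Variables a b c : nat.

Definition theta_length (i : 'I_3) : nat := nth 0%N [:: a; b; c] i.

(* inl false and inl true are the end vertices u and v; inr (i, j) is the     *)
(* internal vertex at distance j + 1 from u along the i-th path.              *)
Definition theta_vertex : finType :=
  (bool + {i : 'I_3 & 'I_(theta_length i).-1})%type.

(* The k-th vertex along the i-th path from u, for k <= theta_length i. *)
Definition theta_walk (i : 'I_3) (k : nat) : theta_vertex :=
  if k is k'.+1 then
    if (insub k' : option 'I_(theta_length i).-1) is Some j
    then inr (Tagged (fun i => 'I_(theta_length i).-1) j) else inl true
  else inl false.

Definition theta_adj : rel theta_vertex := fun x y =>
  [exists i : 'I_3, exists k : 'I_(theta_length i),
    ((x == theta_walk i k) && (y == theta_walk i k.+1))
    || ((y == theta_walk i k) && (x == theta_walk i k.+1))].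

Lemma theta_adj_sym : symmetric theta_adj.
Proof.
by move=> x y; apply: eq_existsb => i; apply: eq_existsb => k; rewrite orbC.
Qed.

Lemma theta_walk_neq (i : 'I_3) (k : 'I_(theta_length i)) :
  theta_walk i k != theta_walk i k.+1.
Proof.
case: k => [] [|k] lt_k /=; first by case: insubP.
have lt_k' : (k < (theta_length i).-1)%N.
  by rewrite -ltnS (ltn_predK lt_k).
rewrite (insubT (fun k => k < (theta_length i).-1)%N lt_k').
case: insubP => [j _ jE|_] //.
apply/eqP => -[] /eqP; rewrite eq_Tagged => /eqP /(congr1 val) /= kE.
by move: jE; rewrite /= -kE => /n_Sn.
Qed.

Lemma theta_adj_irr : irreflexive theta_adj.
Proof.
move=> x; apply/existsP => -[i] /existsP[k].
by rewrite orbb => /andP[/eqP xE]; rewrite xE (negPf (theta_walk_neq k)).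
Qed.

Definition theta_graph : sgraph := SGraph theta_adj_sym theta_adj_irr.

End Theta.

Definition clock_graph (a b : nat) : sgraph := theta_graph a b 2.

Lemma monomial_prod_supp (I : eqType) (s : seq I) (j : I -> nat) (i : I) :
  i \in s -> j i \in finsupp (monomial_prod s j : {cmonom nat}).
Proof.
rewrite /monomial_prod => /(big_rem i) ->.
by rewrite mdomD in_fsetU mdomU in_fset1 eqxx.
Qed.

Lemma finite_factorizations (m : monomial) :
  finite_set [set p : monomial * monomial | mmul p.1 p.2 = m].
Proof.
pose D := finsupp (m : {cmonom nat}).
pose N := (\max_(i : D) (m : {cmonom nat}) (val i))%N.
pose F (d : {ffun D -> 'I_N.+1}) : monomial :=
  mkcmonom [fsfun i : D => val (d i) | 0%N].
have imF (d : monomial) :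
    (forall i, ((d : {cmonom nat}) i <= (m : {cmonom nat}) i)%N) -> range F d.
  move=> le_dm; exists [ffun i => inord ((d : {cmonom nat}) (val i))] => //.
  apply/eqP/cmP => i; rewrite cmE fsfun_ffun.
  case: insubP => [u uD uE|iD] /=.
    rewrite ffunE inordK ?uE // ltnS (leq_trans (le_dm i)) //.
    by rewrite -uE; apply: (leq_bigmax u).
  by move: (le_dm i); rewrite -[m i]/((m : {cmonom nat}) i) (fsfun_dflt iD);
    case: (d i).
have finF : finite_set (range F) by apply: finite_image; apply: finite_finset.
apply: sub_finite_set (finite_setX finF finF) => -[p q] /= pqE.
by split; apply: imF => i; rewrite -pqE cmM ?leq_addr ?leq_addl.
Qed.

Lemma finite_index_sets (m : monomial) :
  finite_set [set S : {fset nat} | monomial_prod (enum_fset S) id = m].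
Proof.
apply: sub_finite_set (finite_fset (fpowerset (finsupp (m : {cmonom nat})))).
move=> S /= SE; rewrite fpowersetE; apply/fsubsetP => i iS.
by rewrite -SE (@monomial_prod_supp _ _ id).
Qed.

Lemma finite_colorings (V : finType) (m : monomial) :
  finite_set [set kappa : {ffun V -> nat} | monomial_prod (enum V) kappa = m].
Proof.
pose D := finsupp (m : {cmonom nat}).
pose F (g : {ffun V -> D}) : {ffun V -> nat} := [ffun x => val (g x)].
have finF : finite_set (range F) by apply: finite_image; apply: finite_finset.
apply: sub_finite_set finF => kappa /= kE.
have kD x : kappa x \in D by rewrite /D -kE monomial_prod_supp // mem_enum.
exists [ffun x => [` kD x]%fset] => //.
by apply/ffunP => x; rewrite !ffunE.
Qed.

(* Main.v *)
Require Import Defs.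
From HB Require Import structures.
From mathcomp Require Import all_boot all_order all_algebra finmap.
From mathcomp Require Import monalg.
From mathcomp Require Import boolp classical_sets functions cardinality fsbigop.
From mathcomp Require Import ring zify.

(* With E = sum_k e_k z^k, G = 1/(E - zE') = sum_n g_n z^n has nonnegative     *)
(* e-coefficients, since g_n = sum_(k >= 2) (k-1) e_k g_(n-k). Paths and cycles *)
(* have the generating functions EG and z^2 E'' G; write P_n, C_n for them.    *)
(* Triple deletion moves an edge between two of the paths of a theta graph at  *)
(* the cost of two tadpoles, and the same for tadpoles yields, for n = a+b+1,  *)
(* second differences in closed form. Solving that recurrence gives            *)
(*   X(theta_ab2) = e_1 C_(n-1) + C_n - P_n                                    *)
(*     + sum_(j,r,s >= 0) (r+s+1)(rs-j) e_(j+r+s+1) e_j g_(a-r-j) g_(b-s-j).   *)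
(* The negative terms with j >= 2 and s >= 1 are absorbed by the terms with    *)
(* j = 0, after expanding g_(b-s); those with j >= 2 and s = 0 by C_n - P_n =  *)
(* sum_(k >= 2) k(k-2) e_k g_(n-k) - e_1 g_(n-1); the multiples of e_1 by      *)
(* e_1 C_(n-1), as C_(n-1) - 2 g_(n-1) is positive.                            *)

Set Implicit Arguments.
Unset Strict Implicit.
Unset Printing Implicit Defensive.
Import Order.TTheory GRing.Theory Num.Theory.
Local Open Scope ring_scope.

(** * Coloured walks *)

(** Colourings of a theta graph are products of three weighted walks between the same two end
    colours. Inclusion-exclusion on one edge ([walkS]) lets an edge slide from one path to another
    at the cost of two tadpoles ([theta_shift]), and lets tadpoles slide at the cost of cycle times
    path ([tadpole_shift]). Hence, for a fixed number of vertices, the second differences of the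
    clock graphs are explicit in paths and cycles.

    In variables y and z, solving this recurrence is division by (y - z)^2. After multiplication by
    D(y) D(z), where D = E - zE', and by one more factor y - z, the division is exact for each pair
    e_i, e_j separately ([kernel_pair]). This yields [kernel_poly] and the formula [theta_clockE].

    The formula has negative terms. Since [gap] enumerates weighted compositions with parts at least
    2, it satisfies termwise inequalities ([gap_ge_sum], [gap_ge_split]). For each t,
    [clock_level_pos] balances the terms led by e_(t+2), borrowing some multiples of e_1;
    [clock_boundary_pos] shows that e_1 C_(n-1) covers all that is borrowed. The argument runs in
    finitely many variables with one list of e-monomials for all their numbers, which
    [e_positive_truncates] carries to the symmetric function. *)

Section ColouredWalks.

Variables (R : comNzRingType) (I : finType) (x : I -> R).
Implicit Types (p q r : I) (l m a b c : nat).

(* Weighted proper colourings of the l internal vertices of a path of length  *)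
(* l + 1 with end colours p and q.                                            *)
Fixpoint walk l p q : R :=
  if l is l'.+1 then \sum_r (p != r)%:R * x r * walk l' r q else (p != q)%:R.

(* The same with l free vertices attached to a single end of colour q. *)
Fixpoint tail l q : R :=
  if l is l'.+1 then \sum_r (q != r)%:R * x r * tail l' r else 1.

Definition path_sum l : R := if l is l'.+1 then \sum_q x q * tail l' q else 1.

Definition cycle_sum m : R := if m is m'.+1 then \sum_q x q * walk m' q q else 0.

(* Cycle of length m + 1 with a pendant path of length l. *)
Definition tadpole_sum m l : R := \sum_q x q * tail l q * walk m q q.

(* Theta graph with path lengths a + 1, b + 1, c + 1. *)
Definition theta_sum a b c : R :=
  \sum_p \sum_q x p * x q * (walk a p q * walk b p q * walk c p q).

Lemma walk_rec l p q :
  walk l.+1 p q = \sum_r (p != r)%:R * x r * walk l r q.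
Proof. by []. Qed.

Lemma tail_rec l q : tail l.+1 q = \sum_r (q != r)%:R * x r * tail l r.
Proof. by []. Qed.

Lemma sum_neq p (F : I -> R) :
  \sum_r (p != r)%:R * F r = \sum_r F r - F p.
Proof.
rewrite [\sum_r F r](bigD1 p) //= (bigD1 p) //= eqxx mul0r add0r addrAC subrr.
by rewrite add0r; apply: eq_bigr => r; rewrite eq_sym => ->; rewrite mul1r.
Qed.

Lemma walk_cat a b p q :
  \sum_r walk a p r * x r * walk b r q = walk (a + b).+1 p q.
Proof.
elim: a p => [|a IH] p; first by [].
rewrite addSn walk_rec.
under [RHS]eq_bigr do rewrite -IH mulr_sumr.
rewrite exchange_big; apply: eq_bigr => r _; rewrite walk_rec !mulr_suml.
by apply: eq_bigr => t _; ring.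
Qed.

Lemma walk_sym l p q : walk l p q = walk l q p.
Proof.
elim: l p q => [|l IH] p q; first by rewrite /= eq_sym.
rewrite -{1}[l]addn0 -walk_cat walk_rec; apply: eq_bigr => r _.
by rewrite IH /= eq_sym; ring.
Qed.

Lemma sum_walk l q : \sum_r x r * walk l r q = tail l.+1 q.
Proof.
elim: l q => [|l IH] q.
  by apply: eq_bigr => r _; rewrite eq_sym mulr1 mulrC.
rewrite tail_rec.
under [RHS]eq_bigr do rewrite -IH mulr_sumr.
rewrite exchange_big; apply: eq_bigr => r _; rewrite walk_sym walk_rec mulr_sumr.
by apply: eq_bigr => t _; rewrite (walk_sym l r); ring.
Qed.

(** Inclusion-exclusion on the edge at p: without it the internal vertices hang freely from q, and
    the colourings whose vertex next to p also has colour p are subtracted. *)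
Lemma walkS l p q : walk l.+1 p q = tail l.+1 q - x p * walk l p q.
Proof.
rewrite -sum_walk walk_rec; under eq_bigr do rewrite -mulrA.
by rewrite sum_neq.
Qed.

Lemma tailS l q : tail l.+1 q = path_sum l.+1 - x q * tail l q.
Proof. by rewrite tail_rec; under eq_bigr do rewrite -mulrA; rewrite sum_neq. Qed.

Lemma sum_tail2 l m : \sum_q x q * tail l q * tail m q = path_sum (l + m).+1.
Proof.
elim: m l => [|m IH] l.
  by rewrite addn0; apply: eq_bigr => q _; rewrite /= mulr1.
rewrite addnS -addSn -IH.
under eq_bigr do rewrite tail_rec mulr_sumr.
rewrite exchange_big; apply: eq_bigr => r _.
rewrite tail_rec mulr_sumr mulr_suml; apply: eq_bigr => q _.
by rewrite eq_sym; ring.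
Qed.

Lemma closed_walk_split a b q :
  \sum_p x p * (walk a p q * walk b p q) = walk (a + b).+1 q q.
Proof.
by rewrite -walk_cat; apply: eq_bigr => r _; rewrite (walk_sym a q); ring.
Qed.

Lemma theta_sumAC a b c : theta_sum a b c = theta_sum a c b.
Proof. by apply: eq_bigr => p _; apply: eq_bigr => q _; ring. Qed.

(** Marking a second vertex p on the cycle turns the tadpole into a theta graph whose third path is
    cut loose from p, so that [theta_shift] can be checked term by term in p and q. *)
Lemma tadpole_split a b l :
  tadpole_sum (a + b).+1 l
  = \sum_p \sum_q x p * x q * (tail l q * walk a p q * walk b p q).
Proof.
rewrite exchange_big; apply: eq_bigr => q _; rewrite -closed_walk_split.
by rewrite mulr_sumr; apply: eq_bigr => p _; ring.
Qed.

(* The triple-deletion relation of Orellana and Scott, read off [walkS]. *)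
Lemma theta_shift a b c :
  theta_sum a b c.+1 - theta_sum a.+1 b c
  = tadpole_sum (a + b).+1 c.+1 - tadpole_sum (b + c).+1 a.+1.
Proof.
rewrite !tadpole_split -!sumrB; apply: eq_bigr => p _.
rewrite -!sumrB; apply: eq_bigr => q _.
by rewrite !walkS; ring.
Qed.

(** Expand the tail by [tailS] and the closed walk by [walkS]: the two correction terms are the same
    product and cancel. *)
Lemma tadpole_shift m l :
  tadpole_sum m l.+1 - tadpole_sum m.+1 l
  = cycle_sum m.+1 * path_sum l.+1 - path_sum (m + l).+2.
Proof.
have -> : (m + l).+2 = (l + m.+1).+1 by lia.
rewrite -sum_tail2 [in RHS]mulr_suml -!sumrB; apply: eq_bigr => q _.
by rewrite walkS tailS; ring.
Qed.

Lemma tadpole0 l : tadpole_sum 0 l = 0.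
Proof. by apply: big1 => q _; rewrite /= eqxx mulr0. Qed.

Lemma cycle1 : cycle_sum 1 = 0.
Proof. by apply: big1 => q _; rewrite /= eqxx mulr0. Qed.

Lemma tadpole_tail0 m : tadpole_sum m 0 = cycle_sum m.+1.
Proof. by apply: eq_bigr => q _; rewrite /= mulr1. Qed.

Lemma tadpole1 l : tadpole_sum 1 l = path_sum l.+2.
Proof.
by have := tadpole_shift 0 l; rewrite tadpole0 cycle1 mul0r !sub0r => /oppr_inj.
Qed.

(** Two paths of length 1 form a doubled edge, and the indicator of p != q is idempotent. *)
Lemma theta_chord a : theta_sum a 0 0 = cycle_sum a.+2.
Proof.
rewrite -tadpole_tail0 -{2}[a]addn0 tadpole_split.
apply: eq_bigr => p _; apply: eq_bigr => q _ /=.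
by case: eqP => _ /=; ring.
Qed.

Lemma theta_clock0 a :
  theta_sum a 1 0
  = cycle_sum a.+3 + cycle_sum a.+2 * path_sum 1 + cycle_sum a.+3
    - path_sum a.+3 *+ 2.
Proof.
have h1 := theta_shift a 0 0; have h2 := tadpole_shift a.+1 0.
rewrite theta_sumAC (canRL (subrK _) h1) theta_chord tadpole1 !addn0.
rewrite (canRL (subrK _) h2) tadpole_tail0 !addn0; ring.
Qed.

Lemma tadpoleE m l :
  tadpole_sum m l
  = \sum_(i < l.+1) cycle_sum (m + l - i).+1 * path_sum i
    - path_sum (m + l).+1 *+ l.
Proof.
elim: l m => [|l IH] m.
  by rewrite big_ord1 tadpole_tail0 addn0 subn0 mulr1 mulr0n subr0.
rewrite (canRL (subrK _) (tadpole_shift m l)) IH [in RHS]big_ord_recr addSnnS addnK.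
rewrite -addnS mulrSr; set P := path_sum (m + l.+1).+1; set C := cycle_sum m.+1.
by rewrite /= -!/(path_sum l.+1); ring.
Qed.

(* A tadpole whose cycle is a loop has no proper colouring. *)
Lemma path_cycle_rec l :
  path_sum l.+1 *+ l = \sum_(i < l.+1) cycle_sum (l.+1 - i) * path_sum i.
Proof.
have := tadpoleE 0 l; rewrite tadpole0 add0n => /esym/eqP.
rewrite subr_eq0 => /eqP <-; apply: eq_bigr => i _.
by rewrite subSn // -ltnS.
Qed.

End ColouredWalks.

(** * Formal power series *)

Definition fps (R : Type) := nat -> R.

HB.instance Definition _ (R : zmodType) := GRing.Zmodule.copy (fps R) (nat -> R).

Section FpsRing.
Variable R : comNzRingType.
Implicit Types (f g h : fps R) (n : nat).

Definition fps_cst (c : R) : fps R := fun n => c *+ (n == 0)%N.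
Definition fps_mul f g : fps R := fun n => \sum_(i < n.+1) f i * g (n - i)%N.

(** A coefficient of a product depends on truncations only, so the ring axioms are inherited from
    polynomials. *)
Lemma fps_mul_poly N f g n : (n < N)%N ->
  fps_mul f g n = ((\poly_(i < N) f i) * (\poly_(i < N) g i))`_n.
Proof.
move=> ltnN; rewrite coefM; apply: eq_bigr => i _; rewrite !coef_poly.
have -> : (i < N)%N by have := ltn_ord i; lia.
by have -> : (n - i < N)%N by lia.
Qed.

Lemma fps_mulA : associative fps_mul.
Proof.
move=> f g h; apply/funext => n.
set p := fun f : fps R => \poly_(i < n.+1) f i.
transitivity ((p f * (p g * p h))`_n).
  rewrite coefM; apply: eq_bigr => i _.
  by rewrite -fps_mul_poly ?coef_poly ?ltn_ord // ltnS leq_subr.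
rewrite mulrA coefM; apply: eq_bigr => i _.
by rewrite -fps_mul_poly ?coef_poly ?ltn_ord // ltnS leq_subr.
Qed.

Lemma fps_mulC : commutative fps_mul.
Proof.
by move=> f g; apply/funext => n; rewrite !(fps_mul_poly _ _ (ltnSn n)) mulrC.
Qed.

Lemma fps_mul1 : left_id (fps_cst 1) fps_mul.
Proof.
move=> f; apply/funext => n; rewrite /fps_mul big_ord_recl /= subn0 mul1r.
by rewrite big1 ?addr0 // => i _; rewrite /fps_cst /= mulr0n mul0r.
Qed.

Lemma fps_mulDl : left_distributive fps_mul +%R.
Proof.
move=> f g h; apply/funext => n; rewrite /GRing.add /= /fps_mul -big_split /=.
by apply: eq_bigr => i _; rewrite -mulrDl.
Qed.

Lemma fps_1_neq0 : fps_cst 1 != 0 :> fps R.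
Proof.
by apply/eqP => /(congr1 (@^~ 0%N)); rewrite /fps_cst eqxx => /eqP; rewrite oner_eq0.
Qed.

HB.instance Definition _ := GRing.Zmodule_isComNzRing.Build (fps R)
  fps_mulA fps_mulC fps_mul1 fps_mulDl fps_1_neq0.

End FpsRing.

Section FpsTheory.
Variable R : comNzRingType.
Implicit Types (f g h : fps R) (n : nat).

Lemma fpsD f g n : (f + g) n = f n + g n. Proof. by []. Qed.
Lemma fpsN f n : (- f) n = - f n. Proof. by []. Qed.
Lemma fpsM f g n : (f * g) n = \sum_(i < n.+1) f i * g (n - i)%N. Proof. by []. Qed.
Lemma fps1 n : (1 : fps R) n = (n == 0)%:R. Proof. by []. Qed.

Lemma fps_sum (J : Type) (s : seq J) (P : pred J) (F : J -> fps R) n :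
  (\sum_(j <- s | P j) F j) n = \sum_(j <- s | P j) F j n.
Proof. by elim/big_ind2: _ => // ? ? ? ? <- <-. Qed.

Lemma fpsMn f k n : (f *+ k) n = f n *+ k.
Proof. by elim: k => [|k IH]; rewrite ?mulr0n // !mulrS fpsD IH. Qed.

Lemma fps_cst_is_zmod_morphism : zmod_morphism (@fps_cst R).
Proof. by move=> c d; apply/funext => n; rewrite fpsD fpsN /fps_cst mulrnBl. Qed.

Lemma fps_cstM c f n : (fps_cst c * f) n = c * f n.
Proof.
rewrite fpsM big_ord_recl subn0 big1 ?addr0 // => i _.
by rewrite /fps_cst /= mulr0n mul0r.
Qed.

Lemma fps_cst_is_monoid_morphism : monoid_morphism (@fps_cst R).
Proof.
by split=> // c d; apply/funext => n; rewrite fps_cstM /fps_cst mulrnAr.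
Qed.

HB.instance Definition _ :=
  GRing.isZmodMorphism.Build R (fps R) (@fps_cst R) fps_cst_is_zmod_morphism.
HB.instance Definition _ :=
  GRing.isMonoidMorphism.Build R (fps R) (@fps_cst R) fps_cst_is_monoid_morphism.

Definition fpsX : fps R := fun n => (n == 1)%:R.

Lemma fpsXM f n : (fpsX * f) n = if n is n'.+1 then f n' else 0.
Proof.
rewrite fpsM big_ord_recl /= mul0r add0r; case: n => [|n]; first by rewrite big_ord0.
rewrite big_ord_recl /= mul1r subSS subn0 big1 ?addr0 // => i _.
by rewrite mul0r.
Qed.

Lemma fpsXnM k f n : (fpsX ^+ k * f) n = if (k <= n)%N then f (n - k)%N else 0.
Proof.
elim: k n => [|k IH] n; first by rewrite mul1r subn0.
by rewrite exprS -mulrA fpsXM; case: n => [|n] //; rewrite IH.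
Qed.

Lemma fps_truncE f M : (forall n, (M <= n)%N -> f n = 0) ->
  f = \sum_(i < M) fps_cst (f i) * fpsX ^+ i.
Proof.
move=> f0; apply/funext => n; rewrite fps_sum.
transitivity (\sum_(i < M) f i *+ (n == i)); last first.
  apply: eq_bigr => i _; rewrite fps_cstM -[_ ^+ _]mulr1 fpsXnM fps1.
  case: (leqP i n) => [le_in|lt_ni]; last by rewrite (ltn_eqF lt_ni) mulr0.
  by rewrite subn_eq0 eqn_leq le_in andbT mulr_natr.
case: (leqP M n) => [leMn|ltnM].
  by rewrite f0 // big1 // => i _; rewrite gtn_eqF // (leq_trans _ leMn).
rewrite (bigD1 (Ordinal ltnM)) //= eqxx mulr1n big1 ?addr0 // => i.
by rewrite -val_eqE /= eq_sym => /negPf ->.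
Qed.

Definition euler f : fps R := fun n => f n *+ n.

Lemma eulerD f g : euler (f + g) = euler f + euler g.
Proof. by apply/funext => n; rewrite /euler fpsD mulrnDl. Qed.

Lemma eulerN f : euler (- f) = - euler f.
Proof. by apply/funext => n; rewrite /euler fpsN mulNrn. Qed.

Lemma euler1 : euler 1 = 0.
Proof. by apply/funext => n; rewrite /euler fps1; case: n => [|n]; rewrite ?mul0rn. Qed.

Lemma eulerM f g : euler (f * g) = euler f * g + f * euler g.
Proof.
apply/funext => n; rewrite fpsD /euler !fpsM -sumrMnl -big_split.
apply: eq_bigr => i _ /=; rewrite mulrnAl mulrnAr -mulrnDr subnKC //.
by rewrite -ltnS.
Qed.

Lemma euler_prod (J : finType) (F : J -> fps R) :
  euler (\prod_j F j) = \sum_j euler (F j) * \prod_(k | k != j) F k.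
Proof.
have gen (s : seq J) : uniq s -> euler (\prod_(j <- s) F j)
    = \sum_(j <- s) euler (F j) * \prod_(k <- s | k != j) F k.
  elim: s => [_|j s IH /= /andP[js us]]; first by rewrite !big_nil euler1.
  rewrite !big_cons eqxx /= eulerM IH // mulr_sumr; congr (_ * _ + _).
    rewrite [RHS]big_seq_cond [LHS]big_seq; apply: eq_bigl => k.
    by case: eqP => [->|_]; rewrite ?(negPf js) ?andbT.
  apply: eq_big_seq => k ks; rewrite big_cons.
  have -> : j != k by apply: contraNneq js => ->.
  by rewrite mulrCA.
by have := gen (index_enum J) (index_enum_uniq J).
Qed.

Lemma fps_mul_cancel f g h : f 0%N = 1 -> f * g = f * h -> g = h.
Proof.
move=> f0 /eqP; rewrite -subr_eq0 -mulrBr => /eqP fg0; apply/eqP.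
rewrite -subr_eq0; apply/eqP; move: (g - h) fg0 => {g h} g fg0.
apply/funext => n; elim/ltn_ind: n => n IH.
have := congr1 (@^~ n) fg0; rewrite /= fpsM big_ord_recl subn0 f0 mul1r.
rewrite big1 ?addr0 // => i _; rewrite IH ?mulr0 //=.
by have := ltn_ord i; rewrite /bump /=; lia.
Qed.

End FpsTheory.

(** * Path and cycle generating functions *)

Section ElementaryPolynomials.
Variables (R : comNzRingType) (e : nat -> R).

(** All values up to n are kept in a list, since each new one depends on all earlier ones. *)
Fixpoint gap_seq n : seq R :=
  if n is m.+1 then
    rcons (gap_seq m)
      (\sum_(k < m) e k.+2 * (gap_seq m)`_(m - k.+1) *+ k.+1)
  else [:: 1].

(* The coefficients of 1 / (E - z E'). *)
Definition gap n : R := (gap_seq n)`_n.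

(** The coefficient of z^a in z^p G; the test matters because truncated subtraction would give
    [gap 0 = 1] for p > a. *)
Definition gap_shift a p : R := if (p <= a)%N then gap (a - p) else 0.

Definition path_poly n : R := \sum_(k < n.+1) e k * gap (n - k).

Definition cycle_poly n : R := \sum_(k < n.+1) e k * gap (n - k) *+ (k * k.-1).

Lemma size_gap_seq n : size (gap_seq n) = n.+1.
Proof. by elim: n => //= n IH; rewrite size_rcons IH. Qed.

Lemma nth_gap_seq m n : (n <= m)%N -> (gap_seq m)`_n = gap n.
Proof.
elim: m => [|m IH]; first by case: n.
rewrite leq_eqVlt => /orP[/eqP -> //|ltnm].
by rewrite /= nth_rcons size_gap_seq ltnm IH.
Qed.

Lemma gap0 : gap 0 = 1. Proof. by []. Qed.

Lemma gap_rec m : gap m.+1 = \sum_(k < m) e k.+2 * gap (m - k.+1) *+ k.+1.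
Proof.
rewrite /gap /= nth_rcons size_gap_seq ltnn eqxx; apply: eq_bigr => k _.
by rewrite nth_gap_seq // leq_subr.
Qed.

(* The coefficient of e_i e_j y^r z^(i-1-r+j), for j <= r < i, in the kernel K *)
(* such that sum_(a,b) kernel_poly a b y^a z^b = K(y,z) G(y) G(z).             *)
Definition kernel_term i r j : int :=
  (i%:Z - j%:Z) * ((r%:Z - j%:Z) * (i%:Z - 1 - r%:Z) - j%:Z).

Definition kernel_poly a b : R :=
  \sum_(i < (a + b).+2) \sum_(r < i) \sum_(j < r.+1)
    (e i * e j * gap_shift a r * gap_shift b (i.-1 - r + j)) *~ kernel_term i r j.

Definition clock_poly a b : R :=
  e 1 * cycle_poly (a + b) + cycle_poly (a + b).+1 - path_poly (a + b).+1
  + kernel_poly a b.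

End ElementaryPolynomials.

Section GeneratingFunctions.

Variables (R : comNzRingType) (I : finType) (x : I -> R).

Definition elem_series : fps R := \prod_q (1 + fps_cst (x q) * fpsX R).

Local Notation E := elem_series.
Local Notation e := (E : nat -> R).
Local Notation g := (gap e).

Definition gap_series : fps R := g.
Local Notation G := gap_series.

Lemma elem_series_coef k :
  E k = \sum_(A : {set I} | #|A| == k) \prod_(q in A) x q.
Proof.
rewrite /elem_series (eq_bigr (fun q => fps_cst (x q) * fpsX R + 1)); last first.
  by move=> q _; rewrite addrC.
rewrite bigA_distr fps_sum [RHS]big_mkcond /=; apply: eq_bigr => A _.
rewrite -big_mkcond /= big_split /= -rmorph_prod fps_cstM prodr_const.
rewrite -[_ ^+ _]mulr1 fpsXnM fps1 mulrC.
case: (leqP #|A| k) => [le|lt]; last by rewrite (gtn_eqF lt) mul0r.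
rewrite subn_eq0 eqn_leq le /=.
by case: leqP; rewrite ?mul1r ?mul0r.
Qed.

Lemma elem0 : e 0%N = 1.
Proof.
rewrite elem_series_coef (big_pred1 finset.set0) ?big_set0 // => A.
by rewrite cards_eq0.
Qed.

Lemma elem_big k : (#|I| < k)%N -> e k = 0.
Proof.
move=> ltIk; rewrite elem_series_coef big_pred0 // => A.
by apply/negbTE; rewrite neq_ltn (leq_ltn_trans (max_card _) ltIk).
Qed.

Lemma elem1 : e 1%N = \sum_q x q.
Proof.
rewrite elem_series_coef.
rewrite (eq_bigl (fun A => A \in [set [set q] | q : I])); last first.
  move=> A; apply/cards1P/imsetP => [[q ->]|[q _ ->]]; by exists q.
rewrite big_imset /=; last by move=> p q _ _ /finset.set1_inj.
by apply: eq_bigr => q _; rewrite big_set1.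
Qed.

Lemma gap_seriesK : G * (E - euler E) = 1.
Proof.
rewrite mulrC; apply/funext => -[|n].
  by rewrite fpsM big_ord1 fpsD fpsN /euler subr0 elem0 mul1r.
rewrite fpsM !big_ord_recl /= !fpsD !fpsN /euler !subn0 elem0.
rewrite mulr0n subr0 mul1r mulr1n subrr mul0r add0r {1}/G gap_rec.
rewrite -big_split big1 // => k _; rewrite /= fpsD fpsN /bump /= !add1n.
rewrite /gap_series subSS mulrBl -mulrnAl mulrnAl [_ *+ k.+2]mulrS; ring.
Qed.

Definition path_series : fps R := path_sum x.
Definition cycle_series : fps R := cycle_sum x.

Local Notation F := path_series.

Lemma tail_series q :
  (1 + fps_cst (x q) * fpsX R) * ((fun l => tail x l q) : fps R) = F.
Proof.
apply/funext => l; rewrite mulrDl mul1r fpsD -mulrA fps_cstM fpsXM.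
by case: l => [|l]; rewrite ?mulr0 ?addr0 // tailS addrNK.
Qed.

Lemma path_series_tail :
  F = 1 + \sum_q fps_cst (x q) * fpsX R * ((fun l => tail x l q) : fps R).
Proof.
apply/funext => -[|l]; rewrite fpsD fps_sum fps1.
  by rewrite big1 ?addr0 // => q _; rewrite -mulrA fps_cstM fpsXM mulr0.
rewrite /= add0r; apply: eq_bigr => q _.
by rewrite -mulrA fps_cstM fpsXM.
Qed.

Lemma euler_linear c : euler (1 + fps_cst c * fpsX R) = fps_cst c * fpsX R.
Proof.
apply/funext => n; rewrite /euler fpsD fps_cstM fps1 /fpsX.
by case: n => [|[|n]] /=; rewrite ?mulr0n ?mulr0 ?add0r ?mul0rn.
Qed.

(* Multiplying [tail_series] by the product of the other linear factors gives *)
(* euler E * F = E * (F - 1).                                                 *)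
Lemma path_seriesM : F * (E - euler E) = E.
Proof.
have thE : euler E * F = E * (F - 1).
  rewrite {2}path_series_tail addrAC subrr add0r /elem_series euler_prod.
  rewrite mulr_suml mulr_sumr; apply: eq_bigr => q _.
  rewrite euler_linear -{1}(tail_series q) [in RHS](bigD1 q) //=; ring.
by rewrite mulrBr [F * euler E]mulrC thE; ring.
Qed.

Lemma path_seriesE : F = E * G.
Proof. by rewrite -path_seriesM -mulrA [_ * G]mulrC gap_seriesK mulr1. Qed.

Lemma path_cycle_series : F * cycle_series = euler F - F + 1.
Proof.
apply/funext => -[|l]; rewrite fpsM !fpsD fpsN /euler fps1.
  by rewrite big_ord1 mulr0 mulr0n add0r addNr.
rewrite [_%:R]/(0 : R) addr0 mulrSr addrK -[F l.+1]/(path_sum x l.+1).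
rewrite path_cycle_rec [LHS]big_ord_recr subnn /= mulr0 addr0; apply: eq_bigr => i _.
by rewrite mulrC.
Qed.

(** A logarithmic derivative: with [D = E - euler E] and G = 1/D, inserting F = EG into
    [path_cycle_series] makes the cycle series equal to [- euler D * G]. *)
Lemma cycle_seriesE : cycle_series = (euler (euler E) - euler E) * G.
Proof.
apply: (@fps_mul_cancel _ F); first by [].
rewrite path_cycle_series path_seriesE eulerM.
set D := E - euler E; have GD := gap_seriesK; rewrite -/D in GD.
have thG : euler G = - (G * G * euler D).
  have := congr1 (@euler R) GD; rewrite eulerM euler1 => /eqP.
  rewrite addr_eq0 => /eqP h.
  by rewrite -[LHS]mulr1 -GD mulrCA h; ring.
have -> : euler (euler E) = euler E - euler D by rewrite /D eulerD eulerN; ring.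
by rewrite thG; move: (euler D) => tD; rewrite -gap_seriesK; ring.
Qed.

Lemma path_sumE n : path_sum x n = path_poly e n.
Proof. by rewrite -[LHS]/(F n) path_seriesE. Qed.

Lemma cycle_sumE n : cycle_sum x n = cycle_poly e n.
Proof.
rewrite -[LHS]/(cycle_series n) cycle_seriesE fpsM; apply: eq_bigr => k _.
rewrite fpsD fpsN /euler -mulrnA -mulrnAl; congr (_ * _).
case: (k : nat) => [|m]; first by rewrite subrr.
by rewrite -mulrnBr ?leq_pmulr //; congr (_ *+ _); lia.
Qed.

End GeneratingFunctions.

(** * The kernel of clock graphs *)

Lemma sum_square_split (V : nmodType) M (f : nat -> nat -> V) :
  \sum_(i < M) \sum_(j < M) f i j
  = \sum_(i < M) (\sum_(j < i) (f i j + f j i) + f i i).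
Proof.
elim: M => [|M IH]; first by rewrite !big_ord0.
rewrite big_ord_recr [RHS]big_ord_recr /= -IH.
under eq_bigr do rewrite big_ord_recr.
rewrite big_split /= -addrA; congr +%R.
by rewrite big_ord_recr big_split /= addrA [X in X + _]addrC.
Qed.

Section Kernel.

Variables (B : comNzRingType) (y z : B).

Lemma sum_hom_rec (phi : nat -> B) d :
  \sum_(r < d.+1) phi r * (y ^+ r * z ^+ (d - r))
  = z * (\sum_(r < d) phi r * (y ^+ r * z ^+ (d.-1 - r))) + phi d * y ^+ d.
Proof.
rewrite big_ord_recr /= subnn expr0 mulr1; congr (_ + _).
rewrite mulr_sumr; apply: eq_bigr => r _.
have -> : (d - r = (d.-1 - r).+1)%N by have := ltn_ord r; lia.
by rewrite exprS; ring.
Qed.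

(** This and the next two lemmas sum the monomials of degree d - 1 with weights 1, r and r(d - 1 -
    r); the quadratic weight accounts for the factor (y - z)^3 in [kernel_pair]. *)
Lemma sum_hom d : (y - z) * \sum_(r < d) y ^+ r * z ^+ (d.-1 - r) = y ^+ d - z ^+ d.
Proof.
elim: d => [|d IH]; first by rewrite big_ord0; ring.
under eq_bigr do rewrite -[_ * _]mul1r.
rewrite (sum_hom_rec (fun=> 1)) !exprS.
under eq_bigr do rewrite mul1r.
by rewrite mulrDr mulrCA IH; ring.
Qed.

Lemma sum_hom_y d :
  (y - z) ^+ 2 * \sum_(r < d) r%:R * (y ^+ r * z ^+ (d.-1 - r))
  = d%:R * y ^+ d * (y - z) - y * (y ^+ d - z ^+ d).
Proof.
elim: d => [|d IH]; first by rewrite big_ord0; ring.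
rewrite (sum_hom_rec (fun r => r%:R)) !exprS mulrDr mulrCA.
by move: IH; rewrite !exprS expr0 => ->; ring.
Qed.

Lemma sum_hom_yz d :
  (y - z) ^+ 3 * \sum_(r < d) (r * (d.-1 - r))%:R * (y ^+ r * z ^+ (d.-1 - r))
  = d%:R * (y - z) * (y ^+ d * z + y * z ^+ d) - (y * z *+ 2) * (y ^+ d - z ^+ d).
Proof.
elim: d => [|d IH]; first by rewrite big_ord0; ring.
rewrite (_ : \sum_(_ < _) _ =
    z * (\sum_(r < d) (r * (d.-1 - r))%:R * (y ^+ r * z ^+ (d.-1 - r)))
  + z * (\sum_(r < d) r%:R * (y ^+ r * z ^+ (d.-1 - r)))); last first.
  rewrite (sum_hom_rec (fun r => (r * (d - r))%:R)) subnn muln0 mul0r addr0.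
  rewrite -mulrDr -big_split; congr (_ * _); apply: eq_bigr => r _ /=.
  rewrite -mulrDl -natrD; congr (_%:R * _).
  by have := ltn_ord r; nia.
rewrite mulrDr mulrCA IH.
set U := \sum_(r < d) _.
have -> : (y - z) ^+ 3 * (z * U) = (y - z) * z * ((y - z) ^+ 2 * U).
  by ring.
by rewrite sum_hom_y !exprS; ring.
Qed.

(** The coefficient of [c i * c j] on the right of [kernel_seriesE], with i belonging to y and j to
    z. *)
Definition pair_term i j : B :=
  (y - z) * ((i * i.-1)%:R * (y ^+ i * z ^+ j.+1) + (j * j.-1)%:R * (y ^+ i.+1 * z ^+ j)
    - (y + z) * ((1 - i%:R) * (1 - j%:R) * (y ^+ i * z ^+ j)))
  - (y + z) * ((1 - j%:R) * (y ^+ i * z ^+ j.+1) - (1 - i%:R) * (y ^+ i.+1 * z ^+ j)).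

Lemma natr_mulpred n : (n * n.-1)%:R = n%:R * (n%:R - 1) :> B.
Proof. by case: n => [|n]; rewrite ?mul0r // natrM mulrSr /= addrK. Qed.

Lemma pair_term_diag i : pair_term i i = 0.
Proof. by rewrite /pair_term natr_mulpred !exprS; ring. Qed.

(** With d = i - j - 1, the quotient of the symmetrized term by (y - z)^3 is (i - j)(yz)^j times the
    sum of (r(d - r) - j) y^r z^(d - r) over r <= d; the statement has r shifted by j. *)
Lemma kernel_pair i j : (j < i)%N ->
  (y - z) ^+ 3 * (\sum_(r < i | (j <= r)%N)
    (y ^+ r * z ^+ (i.-1 - r + j)) *~ kernel_term i r j)
  = pair_term i j + pair_term j i.
Proof.
move=> ltji; have [d -> {i ltji}] : exists d, i = (j + d.+1)%N.
  by exists (i - j.+1)%N; rewrite addnS -addSn subnKC.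
rewrite big_split_ord big1 ?add0r /=; last by move=> r; have := ltn_ord r; lia.
transitivity ((y - z) ^+ 3 * (d.+1%:R * (y * z) ^+ j *
   (\sum_(r < d.+1) (r * (d.+1.-1 - r))%:R * (y ^+ r * z ^+ (d.+1.-1 - r))
    - j%:R * \sum_(r < d.+1) y ^+ r * z ^+ (d.+1.-1 - r)))).
  congr (_ * _); rewrite add0r mulr_sumr -sumrB mulr_sumr.
  apply: eq_big => [r|r _]; first by rewrite leq_addr.
  have -> : ((j + d.+1).-1 - (j + r) + j = d.+1.-1 - r + j)%N by have := ltn_ord r; lia.
  have -> : kernel_term (j + d.+1) (j + r) j
      = d.+1%:Z * ((r * (d.+1.-1 - r))%N%:Z - j%:Z).
    by rewrite /kernel_term; have := ltn_ord r; nia.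
  rewrite -mulrzl intrM intrB -!pmulrn !exprD exprMn; ring.
rewrite [LHS](_ : _ = d.+1%:R * (y * z) ^+ j *
  ((y - z) ^+ 3 * (\sum_(r < d.+1) (r * (d.+1.-1 - r))%:R * (y ^+ r * z ^+ (d.+1.-1 - r)))
   - j%:R * (y - z) ^+ 2 * ((y - z) * \sum_(r < d.+1) y ^+ r * z ^+ (d.+1.-1 - r))));
  last ring.
rewrite sum_hom_yz sum_hom /pair_term !natr_mulpred natrD exprMn !exprS !exprD !exprS.
ring.
Qed.

Variables (M : nat) (c : nat -> B).

Definition kernel_series : B :=
  \sum_(i < M) \sum_(r < i) \sum_(j < r.+1)
    (c i * c j * (y ^+ r * z ^+ (i.-1 - r + j))) *~ kernel_term i r j.

Variables yE yD yS zE zD zS : B.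
Hypotheses (yEE : yE = \sum_(i < M) 1 * c i * y ^+ i)
  (yDE : yD = \sum_(i < M) (1 - i%:R) * c i * y ^+ i)
  (ySE : yS = \sum_(i < M) (i * i.-1)%:R * c i * y ^+ i)
  (zEE : zE = \sum_(i < M) 1 * c i * z ^+ i)
  (zDE : zD = \sum_(i < M) (1 - i%:R) * c i * z ^+ i)
  (zSE : zS = \sum_(i < M) (i * i.-1)%:R * c i * z ^+ i).

(** The letters E, D, S stand for E, [E - euler E] and [euler (euler E) - euler E] in y or z. Both
    sides are compared pair by pair: diagonal pairs vanish and the others are [kernel_pair]. *)
Lemma kernel_seriesE :
  (y - z) ^+ 3 * kernel_series
  = (y - z) * (z * yS * zE + y * zS * yE - (y + z) * yD * zD)
    - (y + z) * (z * yE * zD - y * zE * yD).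
Proof.
have evM phi psi :
    (\sum_(i < M) phi i * c i * y ^+ i) * (\sum_(i < M) psi i * c i * z ^+ i) =
    \sum_(i < M) \sum_(j < M) phi i * psi j * (c i * c j) * (y ^+ i * z ^+ j).
  rewrite mulr_suml; apply: eq_bigr => i _; rewrite mulr_sumr.
  by apply: eq_bigr => j _; ring.
transitivity (\sum_(i < M) \sum_(j < M) c i * c j * pair_term i j).
  rewrite (sum_square_split _ (fun i j => c i * c j * pair_term i j)) mulr_sumr.
  apply: eq_bigr => i _; rewrite pair_term_diag mulr0 addr0.
  transitivity ((y - z) ^+ 3 * \sum_(j < i) \sum_(r < i | (j <= r)%N)
     (c i * c j * (y ^+ r * z ^+ (i.-1 - r + j))) *~ kernel_term i r j).
    congr (_ * _); rewrite (exchange_big_dep xpredT) //=; apply: eq_bigr => r _.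
    by rewrite (big_ord_widen i (fun j => (c i * c j *
      (y ^+ r * z ^+ (i.-1 - r + j))) *~ kernel_term i r j)).
  rewrite mulr_sumr; apply: eq_bigr => j _.
  rewrite [c j * c i]mulrC -mulrDr -kernel_pair // [RHS]mulrCA; congr (_ * _).
  by rewrite mulr_sumr; apply: eq_bigr => r _; rewrite mulrzAr.
rewrite (_ : _ - _ = (y - z) * (z * (yS * zE) + y * (yE * zS)
   - (y + z) * (yD * zD)) - (y + z) * (z * (yE * zD) - y * (yD * zE))); last ring.
rewrite yEE yDE ySE zEE zDE zSE !evM.
rewrite !(mulr_sumr, =^~ big_split, =^~ sumrB); apply: eq_bigr => i _.
rewrite !(mulr_sumr, =^~ big_split, =^~ sumrB); apply: eq_bigr => j _ /=.
by rewrite /pair_term !exprS; ring.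
Qed.

(** [kernel_seriesE] times G(y) G(z). H will be the series of path sums of index a + b, whose
    defining equation carries a factor y - z; the spare factor on both sides is removed by
    [var_yBz_cancel]. *)
Lemma kernel_identity (yG zG yF zF yC zC H : B) :
  yG * yD = 1 -> zG * zD = 1 -> yF = yE * yG -> zF = zE * zG ->
  yC = yS * yG -> zC = zS * zG -> (y - z) * H = y * yF - z * zF ->
  (y - z) * ((y - z) ^+ 2 * (yG * zG * kernel_series))
  = (y - z) * (z * yC * zF + y * zC * yF - (y + z) * (1 + H - yF - zF)).
Proof.
move=> yGD zGD yFE zFE yCE zCE hE.
have -> : (y - z) * ((y - z) ^+ 2 * (yG * zG * kernel_series))
  = yG * zG * ((y - z) ^+ 3 * kernel_series) by ring.
rewrite kernel_seriesE.
have -> : (y - z) * (z * yC * zF + y * zC * yF - (y + z) * (1 + H - yF - zF))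
  = (y - z) * (z * yC * zF + y * zC * yF)
    - (y + z) * ((y - z) * (1 - yF - zF) + (y - z) * H) by ring.
rewrite hE yCE zCE.
have -> : (y + z) * ((y - z) * (1 - yF - zF) + (y * yF - z * zF))
  = (y + z) * ((y - z) * ((yG * yD) * (zG * zD))
     + z * yF * (zG * zD) - y * zF * (yG * yD)).
  by rewrite yGD zGD; ring.
by rewrite yFE zFE; ring.
Qed.

End Kernel.

(** * Bivariate series *)

Section Bivariate.

Variable R : comNzRingType.

(* A series f in y and z has the coefficient [f b a] at y^a z^b. *)
Definition bifps : comNzRingType := fps (fps R).

Definition in_y : fps R -> bifps := @fps_cst (fps R).
Definition in_z (f : fps R) : bifps := fun b => fps_cst (f b).

HB.instance Definition _ := GRing.RMorphism.on in_y.

Lemma in_z_is_zmod_morphism : zmod_morphism in_z.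
Proof. by move=> f g; apply/funext => b; rewrite /in_z fpsD fpsN rmorphB. Qed.

Lemma in_z_is_monoid_morphism : monoid_morphism in_z.
Proof.
split=> [|f g]; apply/funext => b; rewrite /in_z; first by rewrite rmorph_nat.
by rewrite fpsM rmorph_sum; apply: eq_bigr => i _; rewrite rmorphM.
Qed.

HB.instance Definition _ :=
  GRing.isZmodMorphism.Build (fps R) bifps in_z in_z_is_zmod_morphism.
HB.instance Definition _ :=
  GRing.isMonoidMorphism.Build (fps R) bifps in_z in_z_is_monoid_morphism.

Definition var_y : bifps := in_y (fpsX R).
Definition var_z : bifps := fpsX (fps R).

Lemma in_zX : in_z (fpsX R) = var_z.
Proof. by apply/funext => b; rewrite /in_z rmorph_nat. Qed.

Lemma in_z_cst c : in_z (fps_cst c) = in_y (fps_cst c).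
Proof. by apply/funext => b; rewrite -[LHS]/(fps_cst (c *+ (b == 0)%N)) raddfMn. Qed.

Lemma var_yM f a b : (var_y * f : bifps) b a = if a is a'.+1 then f b a' else 0.
Proof. by rewrite /var_y /in_y fps_cstM fpsXM. Qed.

Lemma var_zM f a b : (var_z * f : bifps) b a = if b is b'.+1 then f b' a else 0.
Proof. by rewrite /var_z fpsXM; case: b. Qed.

Lemma in_yzM f g a b : (in_y f * in_z g : bifps) b a = f a * g b.
Proof. by rewrite /in_y fps_cstM /in_z mulrC fps_cstM mulrC. Qed.

Lemma in_yE f a b : in_y f b a = f a *+ (b == 0)%N.
Proof. by rewrite -[in_y f]mulr1 -(rmorph1 in_z) in_yzM fps1 mulr_natr. Qed.

Lemma in_zE f a b : in_z f b a = f b *+ (a == 0)%N.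
Proof. by rewrite -[in_z f]mul1r -(rmorph1 in_y) in_yzM fps1 mulr_natl. Qed.

Lemma bifpsD f g a b : (f + g : bifps) b a = f b a + g b a. Proof. by []. Qed.
Lemma bifpsN f a b : (- f : bifps) b a = - f b a. Proof. by []. Qed.

Lemma var_yBz_cancel f g : (var_y - var_z) * f = (var_y - var_z) * g -> f = g.
Proof.
move=> /eqP; rewrite -subr_eq0 -mulrBr mulrBl subr_eq0 => /eqP fg; apply/eqP.
rewrite -subr_eq0; apply/eqP; move: (f - g) fg => {f g} f fE.
apply/funext => b; apply/funext => a.
have := congr1 (fun h : bifps => h b a.+1) fE; rewrite var_yM var_zM => ->.
elim: b a => [|b IH] // a.
by have := congr1 (fun h : bifps => h b a.+2) fE; rewrite var_yM var_zM IH.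
Qed.

Lemma second_difference f a b :
  ((var_y - var_z) ^+ 2 * f : bifps) b.+2 a.+2
  = f b.+2 a - f b.+1 a.+1 *+ 2 + f b a.+2.
Proof.
have -> : (var_y - var_z) ^+ 2 * f =
    var_y * (var_y * f) - var_y * (var_z * f) *+ 2 + var_z * (var_z * f) by ring.
by rewrite !bifpsD bifpsN mulr2n bifpsD !var_yM !var_zM -mulr2n.
Qed.

Lemma second_difference1 f a :
  ((var_y - var_z) ^+ 2 * f : bifps) 1 a.+2 = f 1 a - f 0 a.+1 *+ 2.
Proof.
have -> : (var_y - var_z) ^+ 2 * f =
    var_y * (var_y * f) - var_y * (var_z * f) *+ 2 + var_z * (var_z * f) by ring.
by rewrite !bifpsD bifpsN mulr2n bifpsD !(var_yM, var_zM) /= !var_zM /= addr0.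
Qed.

Lemma second_difference0 f a : ((var_y - var_z) ^+ 2 * f : bifps) 0 a.+2 = f 0 a.
Proof.
have -> : (var_y - var_z) ^+ 2 * f =
    var_y * (var_y * f) - var_y * (var_z * f) *+ 2 + var_z * (var_z * f) by ring.
by rewrite !bifpsD bifpsN mulr2n bifpsD !(var_yM, var_zM) /= ?var_zM /= !addr0 subr0.
Qed.

Section SecondDifference.

Variables (f H : bifps) (C F : fps R).
Hypotheses (C0 : C 0 = 0) (C1 : C 1 = 0) (F0 : F 0 = 1).
Hypothesis HE : forall a b, H b a = F (a + b)%N.
Hypothesis fE : (var_y - var_z) ^+ 2 * f
  = var_z * (in_y C * in_z F) + var_y * (in_y F * in_z C)
    - (var_y * (1 + H - in_y F - in_z F) + var_z * (1 + H - in_y F - in_z F)).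

Let g : bifps := 1 + H - in_y F - in_z F.

Let gE a b : g b a
  = (b == 0)%:R * (a == 0)%:R + F (a + b)%N - F a *+ (b == 0)%N - F b *+ (a == 0)%N.
Proof.
rewrite /g !bifpsD !bifpsN in_yE in_zE HE; congr (_ + _ - _ - _).
by case: b => [|b]; rewrite !fps1 /= ?mul1r ?mul0r ?fps1.
Qed.

Let fE' a b : ((var_y - var_z) ^+ 2 * f : bifps) b a
  = (if b is b'.+1 then C a * F b' else 0) + (if a is a'.+1 then F a' * C b else 0)
    - ((if a is a'.+1 then g b a' else 0) + (if b is b'.+1 then g b' a else 0)).
Proof.
rewrite fE -/g !bifpsD bifpsN !bifpsD !var_zM !var_yM.
by case: a b => [|a] [|b]; rewrite ?in_yzM.
Qed.

(** In z-degrees 0 and 1 the second difference loses terms, which gives the initial values for the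
    recurrence [coef_rec]. *)
Lemma coef_bottom a : f 0 a = 0.
Proof. by rewrite -second_difference0 fE' gE /= C0 addn0; ring. Qed.

Lemma coef_next a : f 1 a = C a.+2 - F a.+2.
Proof.
transitivity (f 1 a - f 0 a.+1 *+ 2); first by rewrite coef_bottom mul0rn subr0.
by rewrite -second_difference1 fE' !gE /= C1 F0 addn1 gE /= addn0; ring.
Qed.

Lemma coef_rec a b : f b.+2 a - f b.+1 a.+1 *+ 2 + f b a.+2
  = C a.+2 * F b.+1 + C b.+2 * F a.+1 - F (a + b).+3 *+ 2.
Proof.
by rewrite -second_difference fE' !gE /= !addnS !addSn; ring.
Qed.

End SecondDifference.

End Bivariate.

(** * The closed formula for clock graphs *)

Section ClockFormula.

Variables (R : comNzRingType) (I : finType) (x : I -> R).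

Local Notation E := (elem_series x).
Local Notation e := (E : nat -> R).
Local Notation G := (gap_series x).
Local Notation F := (path_series x).
Local Notation C := (cycle_series x).
Local Notation y := (var_y R).
Local Notation z := (var_z R).
Local Notation cst k := (in_y (fps_cst (e k))).

Section Truncated.

Variable M : nat.
Hypothesis ltIM : (#|I| < M)%N.

(** As M exceeds the number of variables, e_k = 0 for k >= M, so the finite kernel is exact and not
    only a truncation. *)
Definition clock_series : bifps R :=
  in_y G * in_z G * kernel_series y z M (fun k => cst k).

Definition antidiag : bifps R := fun b a => F (a + b)%N.

Lemma elem_multE (phi : nat -> R) (f : fps R) : (forall i, f i = phi i * e i) ->
  f = \sum_(i < M) fps_cst (phi i) * fps_cst (e i) * fpsX R ^+ i.
Proof.
move=> fE; rewrite [LHS](@fps_truncE _ _ M) => [|n leMn].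
  by apply: eq_bigr => i _; rewrite fE rmorphM.
by rewrite fE (elem_big _ (leq_trans ltIM leMn)) mulr0.
Qed.

Lemma in_y_mult (phi : nat -> R) (psi : nat -> bifps R) f :
  (forall i, f i = phi i * e i) -> (forall i, in_y (fps_cst (phi i)) = psi i) ->
  in_y f = \sum_(i < M) psi i * cst i * y ^+ i.
Proof.
move=> /elem_multE -> psiE; rewrite rmorph_sum; apply: eq_bigr => i _.
by rewrite !rmorphM rmorphXn -psiE.
Qed.

Lemma in_z_mult (phi : nat -> R) (psi : nat -> bifps R) f :
  (forall i, f i = phi i * e i) -> (forall i, in_y (fps_cst (phi i)) = psi i) ->
  in_z f = \sum_(i < M) psi i * cst i * z ^+ i.
Proof.
move=> /elem_multE -> psiE; rewrite rmorph_sum; apply: eq_bigr => i _.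
by rewrite !rmorphM rmorphXn /= in_zX !in_z_cst -psiE.
Qed.

Lemma antidiagE : (y - z) * antidiag = y * in_y F - z * in_z F.
Proof.
apply/funext => b; apply/funext => a.
rewrite mulrBl !bifpsD !bifpsN !var_yM !var_zM.
case: a b => [|a] [|b]; rewrite ?in_yE ?in_zE ?eqxx /antidiag ?addn0 //=.
by rewrite addnS -addSn !mulr0n !subrr.
Qed.

Lemma clock_seriesE :
  (y - z) ^+ 2 * clock_series = z * (in_y C * in_z F) + y * (in_y F * in_z C)
    - (y * (1 + antidiag - in_y F - in_z F) + z * (1 + antidiag - in_y F - in_z F)).
Proof.
apply: var_yBz_cancel.
have FE := path_seriesE x; have CE := cycle_seriesE x; have GD := gap_seriesK x.
set D := E - euler E in GD; set S := euler (euler E) - euler E in CE.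
have E1 i : E i = 1 * e i by rewrite mul1r.
have DE i : D i = (1 - i%:R) * e i.
  by rewrite /D fpsD fpsN /euler mulrBl mul1r mulr_natl.
have SE i : S i = (i * i.-1)%:R * e i.
  rewrite /S fpsD fpsN /euler -mulrnA mulr_natl.
  by case: i => [|i]; rewrite ?subrr // -mulrnBr ?leq_pmulr //; congr (_ *+ _); lia.
have cst1 (i : nat) : in_y (fps_cst (1 : R)) = 1 by rewrite !rmorph1.
have cstB i : in_y (fps_cst (1 - i%:R : R)) = 1 - i%:R.
  by rewrite !rmorphB !rmorph1 !rmorph_nat.
have cstN i : in_y (fps_cst ((i * i.-1)%:R : R)) = (i * i.-1)%:R by rewrite !rmorph_nat.
have yE := in_y_mult E1 cst1; have yD := in_y_mult DE cstB; have yS := in_y_mult SE cstN.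
have zE := in_z_mult E1 cst1; have zD := in_z_mult DE cstB; have zS := in_z_mult SE cstN.
have yGD : in_y G * in_y D = 1 by rewrite -rmorphM GD rmorph1.
have zGD : in_z G * in_z D = 1 by rewrite -rmorphM GD rmorph1.
have yFE : in_y F = in_y E * in_y G by rewrite FE rmorphM.
have zFE : in_z F = in_z E * in_z G by rewrite FE rmorphM.
have yCE : in_y C = in_y S * in_y G by rewrite CE rmorphM.
have zCE : in_z C = in_z S * in_z G by rewrite CE rmorphM.
have -> : z * (in_y C * in_z F) + y * (in_y F * in_z C)
    - (y * (1 + antidiag - in_y F - in_z F) + z * (1 + antidiag - in_y F - in_z F))
  = z * in_y C * in_z F + y * in_z C * in_y F
    - (y + z) * (1 + antidiag - in_y F - in_z F).
  by rewrite !mulrA mulrDl [_ * in_y F * _]mulrAC.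
exact: (kernel_identity yE yD yS zE zD zS yGD zGD yFE zFE yCE zCE antidiagE).
Qed.

Lemma clock_series_coef a b : (a + b < M.-1)%N -> clock_series b a = kernel_poly e a b.
Proof.
move=> ltM; rewrite /clock_series /kernel_series mulr_sumr /kernel_poly.
rewrite (big_ord_widen M (fun i => \sum_(r < i) \sum_(j < r.+1)
    (e i * e j * gap_shift e a r * gap_shift e b (i.-1 - r + j))
      *~ kernel_term i r j)); last by lia.
have shiftE (p : nat) (n : nat) : (fpsX R ^+ p * G) n = gap_shift e n p.
  by rewrite fpsXnM.
rewrite fps_sum fps_sum [RHS]big_mkcond; apply: eq_bigr => i _.
transitivity (\sum_(r < i) \sum_(j < r.+1)
   (e i * e j * gap_shift e a r * gap_shift e b (i.-1 - r + j)) *~ kernel_term i r j);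
  last first.
  (* For i >= a + b + 2 the exponents r and i - 1 - r + j add up to more than a + b, so one of the
     two shifted gaps is 0. *)
  case: ltnP => // lei; apply: big1 => r _; apply: big1 => j _.
  have := ltn_ord r; have := ltn_ord j; rewrite /gap_shift => ltj ltr.
  case: leqP => lera; last by rewrite mulr0 mul0r mul0rz.
  by case: leqP => [|_]; [lia|rewrite mulr0 mul0rz].
rewrite mulr_sumr !fps_sum; apply: eq_bigr => r _.
rewrite mulr_sumr !fps_sum; apply: eq_bigr => j _.
rewrite mulrzAr; set k := kernel_term _ _ _.
have zmE (f : bifps R) : (f *~ k) b a = f b a *~ k.
  have h (f' : bifps R) n : (f' *+ n) b a = f' b a *+ n by rewrite !fpsMn.
  by case: k => n; rewrite ?NegzE ?mulrNz ?bifpsN -?pmulrn h.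
rewrite zmE; congr (_ *~ _).
have -> : in_y G * in_z G * (cst i * cst j * (y ^+ r * z ^+ (i.-1 - r + j)))
  = in_y (fps_cst (e i * e j) * (fpsX R ^+ r * G)) * in_z (fpsX R ^+ (i.-1 - r + j) * G).
  by rewrite !rmorphM !rmorphXn /= in_zX /var_y; ring.
by rewrite in_yzM fps_cstM !shiftE.
Qed.

End Truncated.

Lemma cycle_series1 : C 1 = 0.
Proof. exact: cycle1. Qed.

Lemma kernel_poly0 a : kernel_poly e a 0 = 0.
Proof.
have ltIM : (#|I| < a.+2 + #|I|)%N by lia.
rewrite -(clock_series_coef ltIM); last by lia.
exact: (coef_bottom (C := C) (F := F) (H := antidiag) _ _ (clock_seriesE ltIM)).
Qed.

Lemma kernel_poly1 a :
  kernel_poly e a 1 = cycle_poly e a.+2 - path_poly e a.+2.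
Proof.
have ltIM : (#|I| < a.+3 + #|I|)%N by lia.
rewrite -(clock_series_coef ltIM); last by lia.
rewrite -cycle_sumE -path_sumE.
exact: (coef_next (C := C) (F := F) (H := antidiag) _ cycle_series1 _ _
  (clock_seriesE ltIM)).
Qed.

Lemma kernel_poly_rec a b :
  kernel_poly e a b.+2 - kernel_poly e a.+1 b.+1 *+ 2 + kernel_poly e a.+2 b
  = cycle_sum x a.+2 * path_sum x b.+1 + cycle_sum x b.+2 * path_sum x a.+1
    - path_sum x (a + b).+3 *+ 2.
Proof.
have ltIM : (#|I| < (a + b).+4 + #|I|)%N by lia.
rewrite -!(clock_series_coef ltIM); [|lia|lia|lia].
exact: (coef_rec (C := C) (F := F) (H := antidiag) _ (clock_seriesE ltIM)).
Qed.

(** Kernel and tadpoles agree for b = 0, and [kernel_poly_rec] and [tadpole_shift] give both sides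
    the same increments along a fixed a + b. *)
Lemma kernel_poly_shift a b :
  kernel_poly e a.+1 b.+1 - kernel_poly e a.+2 b
  = tadpole_sum x a.+2 b - tadpole_sum x b.+1 a.+1.
Proof.
elim: b a => [|b IH] a.
  rewrite kernel_poly1 kernel_poly0 tadpole_tail0 tadpole1.
  by rewrite cycle_sumE path_sumE subr0.
have h1 := kernel_poly_rec a.+1 b; have h2 := IH a.+1.
have h3 := tadpole_shift x a.+2 b; have h4 := tadpole_shift x b.+1 a.+1.
rewrite (_ : (b.+1 + a.+1).+2 = (a.+1 + b).+3) in h4; last by lia.
rewrite (_ : (a.+2 + b).+2 = (a.+1 + b).+3) in h3; last by lia.
transitivity ((kernel_poly e a.+1 b.+2 - kernel_poly e a.+2 b.+1 *+ 2
   + kernel_poly e a.+3 b) + (kernel_poly e a.+2 b.+1 - kernel_poly e a.+3 b)).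
  by ring.
transitivity ((tadpole_sum x a.+2 b.+1 - tadpole_sum x a.+3 b)
  + (tadpole_sum x a.+3 b - tadpole_sum x b.+1 a.+2)
  + (tadpole_sum x b.+1 a.+2 - tadpole_sum x b.+2 a.+1)); last by ring.
by rewrite h1 h2 h3 h4; ring.
Qed.

(** Sliding an edge from the b-path to the a-path changes both sides by the same tadpoles; the terms
    of [clock_poly] outside the kernel depend on a + b only. *)
Lemma theta_clockE a b : theta_sum x a 1 b = clock_poly e a.+1 b.+1.
Proof.
elim: b a => [|b IH] a.
  rewrite theta_clock0 /clock_poly addn1 kernel_poly1 -!cycle_sumE -!path_sumE.
  have -> : path_sum x 1 = e 1%N by rewrite elem1; apply: eq_bigr => q _; rewrite mulr1.
  ring.
have h1 := theta_shift x a 1 b; have h2 := kernel_poly_shift a b.+1.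
rewrite (canRL (subrK _) h1) IH addn1 add1n -h2 /clock_poly !addSn !addnS.
ring.
Qed.

End ClockFormula.

(** * Positivity *)

Section Positivity.

Variable R : comNzRingType.
Implicit Types (f h : (nat -> R) -> R) (e : nat -> R).

(** One list s of monomials, with repetitions as multiplicities, serves every e; this uniformity
    later makes the coefficients independent of the number of variables. *)
Definition epos f := exists s : seq (seq nat), forall e, e 0%N = 1 ->
  f e = \sum_(la <- s) \prod_(k <- la) e k.

Lemma epos_eq f h : (forall e, e 0%N = 1 -> f e = h e) -> epos h -> epos f.
Proof. by move=> fh [s hs]; exists s => e e0; rewrite fh ?hs. Qed.

Lemma epos0 : epos (fun=> 0).
Proof. by exists [::] => e _; rewrite big_nil. Qed.

Lemma epos1 : epos (fun=> 1).
Proof. by exists [:: [::]] => e _; rewrite big_seq1 big_nil. Qed.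

Lemma epos_elem k : epos (fun e => e k).
Proof. by exists [:: [:: k]] => e _; rewrite !big_seq1. Qed.

Lemma eposD f h : epos f -> epos h -> epos (fun e => f e + h e).
Proof.
by move=> [s fs] [t ht]; exists (s ++ t) => e e0; rewrite big_cat fs ?ht.
Qed.

Lemma eposM f h : epos f -> epos h -> epos (fun e => f e * h e).
Proof.
move=> [s fs] [t ht]; exists [seq la ++ mu | la <- s, mu <- t] => e e0.
rewrite fs // ht // big_allpairs_dep mulr_suml; apply: eq_bigr => la _.
by rewrite mulr_sumr; apply: eq_bigr => mu _; rewrite big_cat.
Qed.

Lemma eposMn f n : epos f -> epos (fun e => f e *+ n).
Proof.
move=> f_pos; elim: n => [|n IH]; first exact: epos0.
by apply: epos_eq (eposD f_pos IH) => e _; rewrite mulrS.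
Qed.

Lemma eposMz f (k : int) : 0 <= k -> epos f -> epos (fun e => f e *~ k).
Proof. by case: k => // n _; apply: eposMn. Qed.

Lemma epos_sum n (P : pred 'I_n) (F : 'I_n -> (nat -> R) -> R) :
  (forall i, P i -> epos (F i)) -> epos (fun e => \sum_(i < n | P i) F i e).
Proof.
move=> F_pos.
have gen (s : seq 'I_n) : epos (fun e => \sum_(i <- s | P i) F i e).
  elim: s => [|i s IH]; first by apply: epos_eq epos0 => e _; rewrite big_nil.
  case Pi: (P i).
    by apply: epos_eq (eposD (F_pos i Pi) IH) => e _; rewrite big_cons Pi.
  by apply: epos_eq IH => e _; rewrite big_cons Pi.
exact: gen.
Qed.

Lemma gap_pos n : epos (fun e => gap e n).
Proof.
elim/ltn_ind: n => -[|n] IH; first exact: epos1.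
apply: epos_eq (fun e _ => gap_rec e n) _.
apply: epos_sum => k _; apply/eposMn/eposM; first exact: epos_elem.
by apply: IH; lia.
Qed.

Lemma gap_shift_pos n p : epos (fun e => gap_shift e n p).
Proof. by rewrite /gap_shift; case: leqP => _; [apply: gap_pos|apply: epos0]. Qed.

Lemma gap_shift_small e n p : (n < p)%N -> gap_shift e n p = 0.
Proof. by rewrite /gap_shift ltnNge => /negPf ->. Qed.

Lemma gap_shiftD e m n p : gap_shift e (m + n) (m + p) = gap_shift e n p.
Proof. by rewrite /gap_shift leq_add2l subnDl. Qed.

Lemma gap_shiftS e n p : gap_shift e n.+1 p.+1 = gap_shift e n p.
Proof. exact: (gap_shiftD e 1). Qed.

Lemma sum_ord_trunc (V : nmodType) N M (F : nat -> V) :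
  (N <= M)%N -> (forall k, (N <= k)%N -> F k = 0) ->
  \sum_(k < M) F k = \sum_(k < N) F k.
Proof.
move=> leNM F0; rewrite (big_ord_widen M F leNM) [RHS]big_mkcond.
by apply: eq_bigr => k _; case: ltnP => // /F0.
Qed.

Lemma gap_sum e n N : (n <= N)%N ->
  gap e n.+1 = \sum_(k < N) e k.+2 * gap_shift e n.+1 k.+2 *+ k.+1.
Proof.
move=> lenN.
rewrite (@sum_ord_trunc _ _ _ (fun k => e k.+2 * gap_shift e n.+1 k.+2 *+ k.+1) lenN);
  last by move=> k lenk; rewrite gap_shift_small ?mulr0 ?mul0rn.
rewrite gap_rec; apply: eq_bigr => k _.
by rewrite /gap_shift !ltnS ltn_ord subSS.
Qed.

(** Cutting the recursion of [gap] after N terms drops only positive ones; n = 0 is separate because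
    [gap e 0 = 1] is its initial value. *)
Lemma gap_ge_sum n N :
  epos (fun e => gap e n - \sum_(k < N) e k.+2 * gap_shift e n k.+2 *+ k.+1).
Proof.
have term_pos k : epos (fun e => e k.+2 * gap_shift e n k.+2 *+ k.+1).
  by apply/eposMn/eposM; [apply: epos_elem|apply: gap_shift_pos].
case: n term_pos => [|n] term_pos.
  apply: epos_eq epos1 => e _; rewrite big1 ?subr0 // => k _.
  by rewrite gap_shift_small ?mulr0 ?mul0rn.
pose M := (n - N)%N.
apply: (@epos_eq _ (fun e => \sum_(k < M) e (N + k).+2 *
    gap_shift e n.+1 (N + k).+2 *+ (N + k).+1)); last by apply: epos_sum.
move=> e _; rewrite (@gap_sum e n (N + M)); last by rewrite /M; lia.
by rewrite big_split_ord /= addrAC subrr add0r.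
Qed.

(* [gap e n] sums prod_i (k_i - 1) e_(k_i) over the compositions k of n with   *)
(* parts at least 2; those of u.+1 + v are split here according to whether the *)
(* first part ends before u.+1 or not.                                         *)
Lemma gap_split e u v :
  gap e (u.+1 + v) = \sum_(k < u) e k.+2 * gap e (u - k.+1 + v) *+ k.+1
    + \sum_(s < v) e (u + s).+2 * gap e (v - s.+1) *+ (u + s).+1.
Proof.
rewrite addSn gap_rec big_split_ord /=; congr (_ + _); apply: eq_bigr => k _.
  by rewrite addnBAC.
by rewrite -addnS subnDl.
Qed.

(* Among the compositions of u + v, those with a partial sum u and those with  *)
(* a partial sum u - 2 followed by a part at least 3 are disjoint.             *)
Lemma gap_ge_split u v :
  epos (fun e => gap e (u + v) - gap e u * gap e v
    - gap_shift e u 2 * \sum_(s < v) e s.+3 * gap e (v - s.+1) *+ s.+2).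
Proof.
elim/ltn_ind: u => -[|u] IH.
  by apply: epos_eq epos0 => e _; rewrite gap_shift_small // add0n gap0; ring.
pose X e := \sum_(s < v) e s.+3 * gap e (v - s.+1) *+ s.+2.
pose d w e := gap e (w + v) - gap e w * gap e v - gap_shift e w 2 * X e.
pose Z e := \sum_(s < v) e (u + s).+2 * gap e (v - s.+1) *+ (u + s).+1.
have Z_pos : epos Z.
  by apply: epos_sum => s _; apply/eposMn/eposM; [apply: epos_elem|apply: gap_pos].
have d_pos : epos (fun e => \sum_(k < u) e k.+2 * d (u - k.+1)%N e *+ k.+1).
  apply: epos_sum => k _; apply/eposMn/eposM; first exact: epos_elem.
  by apply: IH; lia.
have dE e : gap e (u.+1 + v) - gap e u.+1 * gap e v =
    \sum_(k < u) e k.+2 * d (u - k.+1)%N e *+ k.+1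
    + X e * (\sum_(k < u) e k.+2 * gap_shift e (u - k.+1) 2 *+ k.+1) + Z e.
  rewrite gap_split gap_rec mulr_suml addrAC -sumrB mulr_sumr -big_split.
  by congr (_ + _); apply: eq_bigr => k _ /=; rewrite /d; ring.
(* [gap_shift e u.+1 2] satisfies the recursion over the first part, except at [u.+1 = 2], where it
   is [gap e 0 = 1]; there Z equals X and compensates. *)
case: u {IH} @Z Z_pos d_pos dE => [|[|u]] Z Z_pos d_pos dE.
- apply: epos_eq (eposD d_pos Z_pos) => e _.
  by rewrite dE gap_shift_small // !big_ord0; ring.
- apply: epos_eq d_pos => e _.
  have -> : gap_shift e 2 2 = 1 by [].
  rewrite dE; have -> : \sum_(k < 1) e k.+2 * gap_shift e (1 - k.+1) 2 *+ k.+1 = 0.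
    by rewrite big_ord1 gap_shift_small ?mulr0 ?mul0rn.
  have -> : Z e = X e by apply: eq_bigr => s _; rewrite add1n.
  by rewrite -/(X e); ring.
apply: epos_eq (eposD d_pos Z_pos) => e _.
rewrite dE -/(X e); suff -> : gap_shift e u.+3 2 =
  \sum_(k < u.+2) e k.+2 * gap_shift e (u.+2 - k.+1) 2 *+ k.+1 by ring.
rewrite /gap_shift subSS subn1 /= (@gap_sum e u u.+2); last by lia.
apply: eq_bigr => k _; rewrite /gap_shift.
have -> : (1 < u.+2 - k.+1)%N = (k.+1 < u.+1)%N by lia.
by case: ltnP => // _; congr (_ * gap e _ *+ _); lia.
Qed.

Lemma path_poly_mul e n : e 0%N = 1 ->
  path_poly e n.+1 = \sum_(k < n.+2) e k * gap e (n.+1 - k) *+ k.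
Proof.
move=> e0; rewrite /path_poly !big_ord_recl /= e0 !subn0 mul1r mulr0n add0r.
by rewrite gap_rec addrC -addrA -big_split.
Qed.

Lemma cycle_poly_gap e n : cycle_poly e n.+1
  = \sum_(k < n) e k.+2 * gap e (n - k.+1) *+ (k.+2 * k.+1).
Proof.
rewrite /cycle_poly !big_ord_recl /= !mulr0n !add0r; apply: eq_bigr => k _.
by rewrite /bump /= !add1n subSS.
Qed.

Lemma cycle_path_diff e n : e 0%N = 1 ->
  cycle_poly e n.+1 - path_poly e n.+1
  = \sum_(k < n) e k.+2 * gap e (n - k.+1) *+ (k.+2 * k) - e 1%N * gap e n.
Proof.
move=> e0; rewrite cycle_poly_gap path_poly_mul // !big_ord_recl /=.
rewrite mulr0n add0r mulr1n subn1 opprD addrCA [LHS]addrC -sumrB; congr (_ - _).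
apply: eq_bigr => k _; rewrite /bump /= !add1n subSS -mulrnBr; last by rewrite leq_pmulr.
by congr (_ *+ _); lia.
Qed.

End Positivity.

(** * Balancing the negative terms of the clock formula *)

Section ClockPositivity.

Variable R : comNzRingType.
Implicit Types (e : nat -> R).

Definition kernel_inner e b i r : R :=
  \sum_(j < r.+1) e j * gap_shift e b (i.-1 - r + j) *~ kernel_term i r j.

Lemma kernel_polyE e a b : kernel_poly e a b =
  \sum_(t < a + b) e t.+2 * \sum_(r < t.+2) gap_shift e a r * kernel_inner e b t.+2 r.
Proof.
rewrite /kernel_poly big_ord_recl big_ord0 add0r big_ord_recl.
rewrite [X in X + _]big1 ?add0r; last first.
  move=> [r /= ltr] _; apply: big1 => -[j /= ltj] _.
  have r0 : r = 0%N by move: ltr; rewrite /bump /=; lia.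
  have j0 : j = 0%N by lia.
  by rewrite (_ : kernel_term _ _ _ = 0) ?mulr0z // /kernel_term r0 j0.
apply: eq_bigr => t _; rewrite /bump /= ?add1n mulr_sumr; apply: eq_bigr => r _.
rewrite !mulr_sumr; apply: eq_bigr => j _; rewrite !mulrzAr; congr (_ *~ _).
by rewrite !mulrA; congr (_ * _); rewrite mulrAC.
Qed.

Lemma kernel_inner_split e b i r : kernel_inner e b i r.+1 =
  e 0%N * gap_shift e b (i.-1 - r.+1) *~ kernel_term i r.+1 0
  + e 1%N * gap_shift e b (i.-1 - r.+1 + 1) *~ kernel_term i r.+1 1
  + \sum_(m < r) e m.+2 * gap_shift e b (i.-1 - r.+1 + m.+2) *~ kernel_term i r.+1 m.+2.
Proof.
by rewrite /kernel_inner !big_ord_recl /= addn0 addrA.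
Qed.

Lemma gap_shift_ge_sum b s N :
  epos (fun e : nat -> R => gap_shift e b s
    - \sum_(m < N) e m.+2 * gap_shift e b (s + m.+2) *+ m.+1).
Proof.
case: (leqP s b) => [lesb|ltbs]; last first.
  apply: epos_eq (epos0 R) => e _; rewrite gap_shift_small // big1 ?subr0 // => m _.
  by rewrite gap_shift_small ?mulr0 ?mul0rn //; lia.
apply: epos_eq (gap_ge_sum R (b - s) N) => e _; congr (_ - _).
  by rewrite /gap_shift lesb.
by apply: eq_bigr => m _; rewrite -(gap_shiftD e s (b - s)) subnKC.
Qed.

Lemma kernel_inner0 e b i : kernel_inner e b i 0 = 0.
Proof. by rewrite /kernel_inner big_ord1 /kernel_term !subr0 mul0r mulr0 mulr0z. Qed.

(** Here the exponent s = t - r is positive, so the term j = 0 has a positive coefficient k and can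
    absorb the terms with j >= 2. *)
Lemma kernel_inner_pos b t r : (r < t)%N ->
  epos (fun e : nat -> R => kernel_inner e b t.+2 r.+1
    + e 1%N * gap_shift e b t.+1 *+ t.+1 *+ (r == 0)%N).
Proof.
move=> ltrt; pose s := (t - r)%N; pose k := (t.+2 * r.+1 * s)%N.
(* Spending k through [gap_shift_ge_sum] adds k(m + 1) to the coefficient of the term j = m + 2. *)
pose c (m : nat) : int := k%:Z * m.+1%:Z + kernel_term t.+2 r.+1 m.+2.
have c_ge0 m : (m < r)%N -> 0 <= c m.
  rewrite /c => ltmr.
  have [d rE] : exists d, r = (m + d.+1)%N by exists (r - m.+1)%N; lia.
  have [u tE] : exists u, t = (m + d.+1 + u.+1)%N by exists (t - r.+1)%N; lia.
  have bound : ((d + u.+2) * m.+2 <= (m + d + u).+4 * (m + d).+2 * (u.+1 * m.+1))%N.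
    by apply: leq_trans (leq_pmulr _ _) => //; apply: leq_mul; lia.
  suff -> : k%:Z * m.+1%:Z + kernel_term t.+2 r.+1 m.+2
    = ((m + d + u).+4 * (m + d).+2 * (u.+1 * m.+1))%N%:Z
      - ((d + u.+2) * m.+2)%N%:Z + ((d + u.+2) * (d * u.+1))%N%:Z.
    by rewrite addr_ge0 // subr_ge0.
  have trE : (t - r = u.+1)%N by lia.
  by rewrite /kernel_term /k /s trE tE rE; lia.
(* The coefficient for j = 1 is (t + 1)(r(t - r) - 1), negative only at r = 0, where the borrowed
   multiple of e_1 cancels it. *)
pose c1 : int := kernel_term t.+2 r.+1 1 + (t.+1 * (r == 0))%N%:Z.
have c1_ge0 : 0 <= c1.
  by rewrite /c1 /kernel_term; case: (r) ltrt => [|r'] /= ltr; nia.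
apply: (@epos_eq _ _ (fun e =>
    (gap_shift e b s - \sum_(m < r) e m.+2 * gap_shift e b (s + m.+2) *+ m.+1) *+ k
  + (\sum_(m < r) e m.+2 * gap_shift e b (s + m.+2) *~ c m
  + e 1%N * gap_shift e b s.+1 *~ c1))); last first.
  apply: eposD; first exact/eposMn/gap_shift_ge_sum.
  apply: eposD.
    apply: epos_sum => m _; apply: eposMz; first exact: c_ge0.
    by apply: eposM; [apply: epos_elem|apply: gap_shift_pos].
  by apply: eposMz => //; apply: eposM; [apply: epos_elem|apply: gap_shift_pos].
move=> e e0; rewrite kernel_inner_split e0 mul1r /= subSS -/s addn1.
have -> : kernel_term t.+2 r.+1 0 = k%:Z by rewrite /kernel_term /k /s; nia.
have -> : \sum_(m < r) e m.+2 * gap_shift e b (s + m.+2) *~ c m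
  = (\sum_(m < r) e m.+2 * gap_shift e b (s + m.+2) *+ m.+1) *+ k
  + \sum_(m < r) e m.+2 * gap_shift e b (s + m.+2) *~ kernel_term t.+2 r.+1 m.+2.
  rewrite -sumrMnl -big_split; apply: eq_bigr => m _ /=.
  by rewrite /c mulrzDr -PoszM mulnC -pmulrn mulrnA.
have -> : e 1%N * gap_shift e b t.+1 *+ t.+1 *+ (r == 0)%N
    = e 1%N * gap_shift e b s.+1 *+ t.+1 *+ (r == 0)%N.
  by rewrite /s; case: eqP => [->|_]; rewrite ?subn0 ?mulr0n.
rewrite /c1 mulrzDr -!pmulrn; clearbody k.
by case: (r == 0)%N; rewrite ?muln1 ?muln0 ?mulr1n ?mulr0n; ring.
Qed.

(** The three summands are the share of e_(t+2) in the kernel, its share in C_n - P_n with n = a + b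
    + 1, and the multiple of e_1 borrowed from e_1 C_(n-1). *)
Lemma clock_level_pos a b t :
  epos (fun e : nat -> R =>
    e t.+2 * \sum_(r < t.+2) gap_shift e a r * kernel_inner e b t.+2 r
    + e t.+2 * gap_shift e (a + b).+1 t.+2 *+ (t.+2 * t)
    + e 1%N * e t.+2 * (gap_shift e a t.+1 * gap_shift e b 1
      + gap_shift e a 1 * gap_shift e b t.+1 *+ (0 < t)%N) *+ t.+1).
Proof.
(* The term r = t + 1 of the sum, where the power of z is exhausted. *)
have last_pos : epos (fun e : nat -> R =>
    gap_shift e a t.+1 * kernel_inner e b t.+2 t.+1
    + gap_shift e (a + b).+1 t.+2 *+ (t.+2 * t)
    + e 1%N * gap_shift e a t.+1 * gap_shift e b 1 *+ t.+1).
  case: (ltnP t a) => [ltta|leat]; last first.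
    apply: epos_eq (eposMn (t.+2 * t) (gap_shift_pos R (a + b).+1 t.+2)) => e _.
    by rewrite (@gap_shift_small _ e a) //; ring.
  pose w := (a - t.+1)%N.
  (* By [gap_ge_split] the (t + 2)t copies of [gap e (w + b)] supply as many of [gap e w * gap e b];
     expanding [gap e b] by [gap_ge_sum] pays for the terms j = m + 2, of coefficient -(m + 2)(t -
     m), and leaves c m. *)
  pose c (m : nat) := (t.+2 * t * m.+1 - m.+2 * (t - m))%N.
  apply: (@epos_eq _ _ (fun e =>
      (gap e (w + b) - gap e w * gap e b
        - gap_shift e w 2 * \sum_(s < b) e s.+3 * gap e (b - s.+1) *+ s.+2) *+ (t.+2 * t)
    + gap_shift e w 2 * (\sum_(s < b) e s.+3 * gap e (b - s.+1) *+ s.+2) *+ (t.+2 * t)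
    + gap e w * (gap e b - \sum_(m < t) e m.+2 * gap_shift e b m.+2 *+ m.+1) *+ (t.+2 * t)
    + gap e w * \sum_(m < t) e m.+2 * gap_shift e b m.+2 *+ c m)); last first.
    apply: eposD; last first.
      apply: eposM; first exact: gap_pos.
      by apply: epos_sum => m _; apply/eposMn/eposM; [apply: epos_elem|apply: gap_shift_pos].
    apply: eposD; last by apply/eposMn/eposM; [apply: gap_pos|apply: gap_ge_sum].
    apply: eposD; first exact/eposMn/gap_ge_split.
    apply/eposMn/eposM; first exact: gap_shift_pos.
    by apply: epos_sum => s _; apply/eposMn/eposM; [apply: epos_elem|apply: gap_pos].
  move=> e e0; rewrite kernel_inner_split /= subSS subnn !add0n.
  have -> : gap_shift e a t.+1 = gap e w by rewrite /gap_shift ltta.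
  have -> : gap_shift e (a + b).+1 t.+2 = gap e (w + b).
    rewrite gap_shiftS /gap_shift ifT; last by lia.
    by congr (gap e _); rewrite /w; lia.
  have -> : kernel_term t.+2 t.+1 0 = 0 by rewrite /kernel_term; ring.
  have -> : kernel_term t.+2 t.+1 1 = - t.+1%:Z by rewrite /kernel_term; nia.
  have -> : \sum_(m < t) e m.+2 * gap_shift e b m.+2 *~ kernel_term t.+2 t.+1 m.+2
    = \sum_(m < t) e m.+2 * gap_shift e b m.+2 *+ c m
    - (\sum_(m < t) e m.+2 * gap_shift e b m.+2 *+ m.+1) *+ (t.+2 * t).
    rewrite -sumrMnl -sumrB; apply: eq_bigr => m _.
    have -> : kernel_term t.+2 t.+1 m.+2 = (c m)%:Z - (m.+1 * (t.+2 * t))%N%:Z.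
      rewrite /c /kernel_term; move: (nat_of_ord m) (ltn_ord m) => {}m ltmt.
      have bound : (m.+2 * (t - m) <= t.+2 * t * m.+1)%N.
        by apply: leq_trans (leq_pmulr _ _) => //; apply: leq_mul; lia.
      have [d tE] : exists d, t = (m + d.+1)%N by exists (t - m.+1)%N; lia.
      have tmE : (t - m = d.+1)%N by lia.
      by rewrite -subzn // tmE tE; lia.
    by rewrite mulrzBr -!pmulrn (mulrnA _ m.+1).
  by rewrite mulr0z mulrNz -pmulrn; ring.
(* The other terms; the term r = 1 absorbs the remaining multiple of e_1. *)
have inner_pos : epos (fun e : nat -> R => \sum_(r < t) gap_shift e a r.+1 *
   (kernel_inner e b t.+2 r.+1 + e 1%N * gap_shift e b t.+1 *+ t.+1 *+ ((r : nat) == 0%N))).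
  apply: epos_sum => r _; apply: eposM; first exact: gap_shift_pos.
  exact: kernel_inner_pos.
apply: epos_eq (eposM (epos_elem R t.+2) (eposD last_pos inner_pos)) => e _.
rewrite big_ord_recr big_ord_recl /= kernel_inner0 mulr0 add0r.
under [in RHS]eq_bigr do rewrite mulrDr.
rewrite big_split /=.
have -> : \sum_(r < t) gap_shift e a r.+1 *
     (e 1%N * gap_shift e b t.+1 *+ t.+1 *+ ((r : nat) == 0%N))
   = gap_shift e a 1 * (e 1%N * gap_shift e b t.+1) *+ t.+1 *+ (0 < t)%N.
  case: (t) => [|t']; first by rewrite big_ord0.
  rewrite big_ord_recl big1 => [|r _]; last by rewrite mulr0n mulr0.
  by rewrite addr0 /=; ring.
have -> : \sum_(i < t) gap_shift e a (bump 0 i) * kernel_inner e b t.+2 (bump 0 i)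
  = \sum_(i < t) gap_shift e a i.+1 * kernel_inner e b t.+2 i.+1 by [].
by case: (0 < t)%N; ring.
Qed.

(** The cycle polynomial contains [gap] twice. One copy pays for the term -e_1 g_(n-1) of C_n - P_n;
    the other covers the borrowed sum, which has exactly the shape bounded by [gap_ge_split]. *)
Lemma clock_boundary_pos a b :
  epos (fun e : nat -> R => cycle_poly e (a.+1 + b.+1) - gap e (a.+1 + b.+1)
    - \sum_(t < a.+1 + b.+1) e t.+2 * (gap_shift e a.+1 t.+1 * gap_shift e b.+1 1
      + gap_shift e a.+1 1 * gap_shift e b.+1 t.+1 *+ (0 < t)%N) *+ t.+1).
Proof.
apply: (@epos_eq _ _ (fun e =>
    (\sum_(k < (a + b).+1) e k.+2 * gap e ((a + b).+1 - k.+1) *+ (k.+1 * k))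
  + (gap e (a.+2 + b) - gap e a.+2 * gap e b
     - gap_shift e a.+2 2 * \sum_(s < b) e s.+3 * gap e (b - s.+1) *+ s.+2))); last first.
  apply: eposD; last exact: gap_ge_split.
  by apply: epos_sum => k _; apply/eposMn/eposM; [apply: epos_elem|apply: gap_pos].
move=> e _; set n := (a + b).+1.
have -> : (a.+1 + b.+1 = n.+1)%N by rewrite /n; lia.
have -> : (a.+2 + b = n.+1)%N by rewrite /n; lia.
have -> : cycle_poly e n.+1 =
    \sum_(k < n) e k.+2 * gap e (n - k.+1) *+ (k.+1 * k) + gap e n.+1 + gap e n.+1.
  rewrite cycle_poly_gap gap_rec -!big_split; apply: eq_bigr => k _ /=.
  by rewrite -!mulrnDr; congr (_ *+ _); lia.
have -> : \sum_(t < n.+1) e t.+2 * (gap_shift e a.+1 t.+1 * gap_shift e b.+1 1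
      + gap_shift e a.+1 1 * gap_shift e b.+1 t.+1 *+ (0 < t)%N) *+ t.+1
  = gap e a.+2 * gap e b
    + gap_shift e a.+2 2 * \sum_(s < b) e s.+3 * gap e (b - s.+1) *+ s.+2; last by ring.
rewrite (@gap_sum _ e a.+1 n.+1); last by rewrite /n; lia.
have -> : \sum_(s < b) e s.+3 * gap e (b - s.+1) *+ s.+2
    = \sum_(s < n) e s.+3 * gap_shift e b.+1 s.+2 *+ s.+2.
  rewrite (@sum_ord_trunc _ b n (fun s => e s.+3 * gap_shift e b.+1 s.+2 *+ s.+2));
    [|by rewrite /n; lia|].
    by apply: eq_bigr => s _; rewrite /gap_shift !ltnS ltn_ord subSS.
  by move=> s lebs; rewrite gap_shift_small ?mulr0 ?mul0rn.
have -> : \sum_(s < n) e s.+3 * gap_shift e b.+1 s.+2 *+ s.+2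
    = \sum_(t < n.+1) e t.+2 * gap_shift e b.+1 t.+1 *+ (0 < t)%N *+ t.+1.
  by rewrite [RHS]big_ord_recl [X in X + _]mulr0n add0r.
rewrite mulr_suml mulr_sumr -big_split; apply: eq_bigr => t _ /=.
have gap_shift0 m : gap_shift e m 0 = gap e m by rewrite /gap_shift subn0.
rewrite !gap_shiftS !gap_shift0.
by case: (0 < t)%N; rewrite ?mulr1n ?mulr0n; ring.
Qed.

Lemma clock_poly_pos a b :
  epos (fun e : nat -> R => clock_poly e a.+1 b.+1).
Proof.
set n := (a.+1 + b.+1)%N.
apply: epos_eq (eposD (eposM (epos_elem R 1) (clock_boundary_pos a b))
  (@epos_sum _ n xpredT _ (fun t _ => clock_level_pos a.+1 b.+1 t))) => e e0.
rewrite /clock_poly -/n -(addrA (_ * _)).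
rewrite cycle_path_diff // kernel_polyE -/n !big_split /=.
have -> : \sum_(k < n) e k.+2 * gap e (n - k.+1) *+ (k.+2 * k)
   = \sum_(t < n) e t.+2 * gap_shift e n.+1 t.+2 *+ (t.+2 * t).
  by apply: eq_bigr => t _; rewrite gap_shiftS /gap_shift ltn_ord.
have -> : \sum_(t < n) e 1%N * e t.+2 * (gap_shift e a.+1 t.+1 * gap_shift e b.+1 1
      + gap_shift e a.+1 1 * gap_shift e b.+1 t.+1 *+ (0 < t)%N) *+ t.+1
  = e 1%N * \sum_(t < n) e t.+2 * (gap_shift e a.+1 t.+1 * gap_shift e b.+1 1
      + gap_shift e a.+1 1 * gap_shift e b.+1 t.+1 *+ (0 < t)%N) *+ t.+1.
  by rewrite mulr_sumr; apply: eq_bigr => t _; rewrite -mulrA mulrnAr.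
by ring.
Qed.

End ClockPositivity.

(** * Colourings of theta graphs *)

Section WalkColourings.

Variables (R : comNzRingType) (I : finType) (x : I -> R).

(** The same case split as [theta_walk]: [insub] first fails at k = l + 1, the far end, of colour
    q. *)
Definition path_colour l p q (h : 'I_l -> I) (k : nat) : I :=
  if k is k'.+1 then if (insub k' : option 'I_l) is Some j then h j else q else p.

Definition path_weight l p q (h : {ffun 'I_l -> I}) : R :=
  \prod_(k < l.+1) (path_colour p q h k != path_colour p q h k.+1)%:R
  * \prod_j x (h j).

Definition ffun_cons l (rh : I * {ffun 'I_l -> I}) : {ffun 'I_l.+1 -> I} :=
  [ffun k => if unlift ord0 k is Some j then rh.2 j else rh.1].

Lemma ffun_cons_bij l : bijective (@ffun_cons l).
Proof.
exists (fun h : {ffun 'I_l.+1 -> I} => (h ord0, [ffun j => h (lift ord0 j)])).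
  move=> [r h]; rewrite /ffun_cons !ffunE unlift_none; congr (_, _).
  by apply/ffunP => j; rewrite !ffunE liftK.
move=> h; apply/ffunP => k; rewrite !ffunE.
by case: unliftP => [j ->|->]; rewrite ?ffunE.
Qed.

Lemma path_colour_cons l p q r (h : {ffun 'I_l -> I}) k :
  path_colour p q (ffun_cons (r, h)) k.+1 = path_colour r q h k.
Proof.
case: k => [|k] /=; case: insubP => [j lt_j jE|nlt].
- rewrite ffunE; have -> : j = ord0 by apply/val_inj.
  by rewrite unlift_none.
- by rewrite ltn0Sn in nlt.
- have ltk : (k < l)%N by rewrite -ltnS.
  rewrite ffunE (insubT (fun k => (k < l)%N) ltk).
  have -> : j = lift ord0 (Sub k ltk) by apply/val_inj; rewrite jE.
  by rewrite liftK.
by case: insubP => // j; rewrite -ltnS (negPf nlt).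
Qed.

Lemma path_weight_cons l p q r (h : {ffun 'I_l -> I}) :
  path_weight p q (ffun_cons (r, h)) = (p != r)%:R * x r * path_weight r q h.
Proof.
rewrite /path_weight big_ord_recl [\prod_j _]big_ord_recl ffunE unlift_none.
rewrite (eq_bigr (fun k : 'I_l.+1 => (path_colour r q h k
    != path_colour r q h k.+1)%:R)) => [|k _]; last first.
  by rewrite lift0 !path_colour_cons.
rewrite [X in _ * (_ * X)](eq_bigr (fun j => x (h j))) => [|j _]; last first.
  by rewrite ffunE liftK.
rewrite path_colour_cons /=; ring.
Qed.

Lemma walk_colourings l p q : walk x l p q = \sum_h @path_weight l p q h.
Proof.
elim: l p => [|l IH] p.
  rewrite (big_pred1 (finfun (fun j : 'I_0 => p))) => [|h].
    by rewrite /path_weight big_ord1 big_ord0 mulr1 /= insubF.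
  by apply/esym/eqP/ffunP => -[].
rewrite walk_rec (reindex (@ffun_cons l)); last exact/onW_bij/ffun_cons_bij.
under [LHS]eq_bigr do rewrite IH mulr_sumr.
by rewrite pair_big; apply: eq_bigr => -[r h] _; rewrite path_weight_cons.
Qed.

End WalkColourings.

(** The interiors of the three paths differ in size, so their colourings form a dependent
    product. *)
Lemma sum_fprod (R : comNzRingType) (J : finType) (T : J -> finType)
    (f : forall j, T j -> R) :
  \sum_(g : fprod T) \prod_j f j (g j) = \prod_j \sum_(t : T j) f j t.
Proof.
pose f' j := [ffun t => f j t].
transitivity (\sum_(g : fprod T) \prod_(j in J) f' j (g j)).
  by apply: eq_bigr => g _; apply: eq_bigr => j _; rewrite ffunE.
rewrite big_fprod -(bigA_distr_big_dep _ (fun j t => untag 0 (f' j) t)).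
apply: eq_bigr => j _; rewrite -(big_tag f').
by apply: eq_bigr => t _; rewrite ffunE.
Qed.

Section ThetaColourings.

Variables (R : comNzRingType) (I : finType) (x : I -> R) (a b c : nat).

Local Notation A := a.+1.
Local Notation B := b.+1.
Local Notation C := c.+1.
Local Notation len i := (theta_length A B C i).
Local Notation V := (theta_vertex A B C).

Definition theta_proper (kappa : V -> I) : bool :=
  [forall i : 'I_3, forall k : 'I_(len i),
    kappa (theta_walk A B C i k) != kappa (theta_walk A B C i k.+1)].

Lemma theta_lengthS i : len i = (len i).-1.+1.
Proof. by case: i => -[|[|[|]]]. Qed.

Let piece (i : 'I_3) : finType := {ffun 'I_(len i).-1 -> I}.

Definition theta_glue (g : (I * I) * fprod piece) : {ffun V -> I} :=
  [ffun v => match v with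
    | inl false => g.1.1 | inl true => g.1.2 | inr t => g.2 (tag t) (tagged t)
    end].

Lemma theta_glue_bij : bijective theta_glue.
Proof.
exists (fun k : {ffun V -> I} => ((k (inl false), k (inl true)),
  [fprod i => [ffun j => k (inr (Tagged (fun i => 'I_(len i).-1) j))]] : fprod piece)).
  move=> [[p q] g]; rewrite !ffunE; congr (_, _); apply/fprodP => i.
  by rewrite fprodE; apply/ffunP => j; rewrite !ffunE.
move=> k; apply/ffunP => -[[]|[i j]]; rewrite !ffunE //=.
by rewrite fprodE ffunE.
Qed.

Lemma theta_glue_walk g i k :
  theta_glue g (theta_walk A B C i k) = path_colour g.1.1 g.1.2 (g.2 i) k.
Proof.
by rewrite /theta_glue ffunE; case: k => [|k] /=; last case: insubP.
Qed.

Lemma theta_glue_proper g : (theta_proper (theta_glue g))%:R = \prod_(i < 3)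
  \prod_(k < (len i).-1.+1) (path_colour g.1.1 g.1.2 (g.2 i) k
     != path_colour g.1.1 g.1.2 (g.2 i) k.+1)%:R :> R.
Proof.
have natr_forall (J : finType) (P : pred J) :
    [forall j, P j]%:R = \prod_j (P j)%:R :> R.
  case: forallP => [Pall|Pn]; first by rewrite big1 // => j _; rewrite Pall.
  have /forallPn[j Pj] : ~~ [forall j, P j] by apply/forallP.
  by rewrite (bigD1 j) //= (negPf Pj) mul0r.
rewrite natr_forall; apply: eq_bigr => i _; rewrite natr_forall.
pose F k : R := (path_colour g.1.1 g.1.2 (g.2 i) k
  != path_colour g.1.1 g.1.2 (g.2 i) k.+1)%:R.
rewrite -[RHS]/(\prod_(k < (len i).-1.+1) F k).
rewrite -(big_mkord xpredT F) -theta_lengthS big_mkord.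
by apply: eq_bigr => k _; rewrite !theta_glue_walk.
Qed.

Lemma theta_colourings :
  \sum_(kappa : {ffun V -> I}) (theta_proper kappa)%:R * \prod_v x (kappa v)
  = theta_sum x a b c.
Proof.
rewrite (reindex theta_glue); last exact/onW_bij/theta_glue_bij.
transitivity (\sum_pq \sum_(g : fprod piece)
  x pq.1 * x pq.2 * \prod_i path_weight x pq.1 pq.2 (g i)).
  rewrite pair_big; apply: eq_bigr => -[[p q] g] _ /=.
  rewrite theta_glue_proper big_split /= mulrCA; congr (_ * _).
  rewrite big_sumType /= big_bool !ffunE /= [x q * _]mulrC; congr (_ * _).
  rewrite sig_big_dep; apply: eq_bigr => -[i j] _.
  by rewrite ffunE.
rewrite /theta_sum [RHS]pair_big; apply: eq_bigr => -[p q] _ /=.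
rewrite -mulr_sumr; congr (_ * _).
rewrite (sum_fprod (fun i (h : piece i) => path_weight x p q h)).
under eq_bigr do rewrite -walk_colourings.
by rewrite !big_ord_recl big_ord0 mulr1 mulrA.
Qed.

End ThetaColourings.

(** * Truncation to finitely many variables *)

(** Used with h induced by the inclusion of 'I_N in nat: a monomial in the first N variables arises
    only from index sets and colourings below N. *)
Lemma fsbig_inj_fin (T : choiceType) (J : finType) (h : J -> T) (P : set T)
    (F : T -> int) : injective h ->
  (forall t, P t -> F t != 0 -> exists j, t = h j) ->
  \sum_(t \in P) F t = \sum_(j | `[< P (h j) >]) F (h j).
Proof.
move=> h_inj hP.
have PE : P = [set` (fun t => `[< P t >])]%classic.
  by apply/funext => t; rewrite -[RHS]/(is_true `[< P t >]) asboolE.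
transitivity (\sum_(t \in [set` (fun t => `[< P t >])]%classic) F t).
  by rewrite -PE.
rewrite -(bigfs _ (r := [seq h j | j <- enum J])).
- by rewrite big_map big_enum_cond; apply: eq_bigl.
- by rewrite map_inj_uniq ?enum_uniq.
move=> t /asboolP Pt; apply: contraNeq => Ft.
have [j ->] := hP t Pt Ft.
by apply: map_f; rewrite mem_enum.
Qed.

Section Truncation.

Local Notation ser := {malg int[monomial]}.

Definition malg_var N (i : 'I_N) : ser := << ucm (i : nat) >>.

Definition monomial_below N (m : monomial) :=
  forall i, i \in finsupp (m : {cmonom nat}) -> (i < N)%N.

(* The series f is computed by the polynomials F N in the variables x_0, ...,  *)
(* x_(N - 1).                                                                  *)
Definition truncates (F : nat -> ser) (f : series) :=
  forall N m, monomial_below N m -> f m = (F N)@_m.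

Lemma prod_malg_var (J : Type) (s : seq J) (k : J -> nat) :
  \prod_(j <- s) (<< ucm (k j) >> : ser) = << monomial_prod s k >>.
Proof.
rewrite /monomial_prod.
have mulU (m1 m2 : monomial) :
    (<< mmul m1 m2 >> : ser) = << m1 >> * << m2 >>.
  by rewrite malgM_def fgmulUU mulr1.
apply/esym; exact: (big_morph (fun m : monomial => << m >> : ser) mulU (erefl _)).
Qed.

Lemma truncates1 : truncates (fun=> 1) series1.
Proof. by move=> N m _; rewrite /series1 mcoeff1. Qed.

Lemma truncatesM F G f g : truncates F f -> truncates G g ->
  truncates (fun N => F N * G N) (series_mul f g).
Proof.
move=> Ff Gg N m ltmN; rewrite /series_mul.
pose r := [seq (p, q) | p <- enum_fset (msupp (F N)), q <- enum_fset (msupp (G N))].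
have fE p : mmul p.1 p.2 = m -> (f p.1 = (F N)@_p.1) * (g p.2 = (G N)@_p.2).
  move=> pm; split; [apply: Ff|apply: Gg] => i ip; apply: ltmN;
    by rewrite -pm mdomD in_fsetU ip ?orbT.
have -> : [set p : monomial * monomial | mmul p.1 p.2 = m]%classic
    = [set` (fun p : monomial * monomial => mmul p.1 p.2 == m)]%classic.
  by apply/seteqP; split=> p /=; [move=> pm; apply/eqP|move=> /eqP].
rewrite -(bigfs _ (r := r)).
- rewrite big_mkcond big_allpairs mcoeffMl; apply: eq_bigr => p _.
  apply: eq_bigr => q _ /=; case: eqP => [pq|]; rewrite ?mulr0n // mulr1n.
  by rewrite (fE (p, q) pq).1 (fE (p, q) pq).2.
- by apply: allpairs_uniq => // [[? ?] [? ?]].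
move=> [p q] /eqP pq; apply: contraNeq.
rewrite (fE (p, q) pq).1 (fE (p, q) pq).2 /= mulf_eq0 negb_or => /andP[Fp Gq].
by apply/allpairsP; exists (p, q); split; rewrite // -mcoeff_neq0.
Qed.

Lemma truncates_elementary k :
  truncates (fun N => elem_series (@malg_var N) k) (elementary k).
Proof.
move=> N m ltmN; rewrite elem_series_coef /elementary raddf_sum /=.
pose h (A : {set 'I_N}) : {fset nat} := [fset val i | i in A]%fset.
have h_inj : injective h.
  move=> A B AB; apply/setP => i.
  have hE (D : {set 'I_N}) : (val i \in h D) = (i \in D).
    apply/imfsetP/idP => [[j jD /val_inj ->] //|iD]; by exists i.
  by rewrite -!hE AB.
have hcard A : #|` h A|%fset = #|A|.
  by rewrite card_imfset ?cardE //; apply: val_inj.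
rewrite (fsbig_inj_fin h_inj) => [|S /= Sk Sm].
  apply: eq_big => [A|A _]; first by rewrite -hcard; apply/asboolP/eqP.
  rewrite /malg_var -big_enum /= prod_malg_var mcoeffU1; congr (_ == _)%:R.
  rewrite /monomial_prod -(big_map val predT (fun i => ucm i)).
  apply: perm_big; apply: uniq_perm => [||i]; rewrite ?fset_uniq //.
    by rewrite map_inj_uniq ?enum_uniq //; apply: val_inj.
  apply/imfsetP/mapP => [[j jA ->]|[j jA ->]]; exists j => //; by rewrite ?mem_enum in jA *.
have {}Sm : monomial_prod (enum_fset S) id = m
  by apply/eqP; apply: contraNT Sm => /negPf ->.
exists [set i : 'I_N | val i \in S]; apply/fsetP => i.
apply/idP/imfsetP => [iS|[j /=]]; last by rewrite inE => jS ->.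
have ltiN : (i < N)%N by apply: ltmN; rewrite -Sm (@monomial_prod_supp _ _ id).
by exists (Ordinal ltiN); rewrite //= inE.
Qed.

Lemma truncates_elementary_part (la : int_partition) :
  truncates (fun N => \prod_(k <- la) elem_series (@malg_var N) k) (elementary_part la).
Proof.
rewrite /elementary_part; elim: (parts la) => [|k s IH] /=.
  by move=> N m ltmN; rewrite big_nil; exact: (truncates1 ltmN).
move=> N m ltmN; rewrite big_cons.
exact: (truncatesM (truncates_elementary k) IH ltmN).
Qed.

Lemma truncates_chromatic (G : sgraph)
    (P : forall N, {ffun vertex G -> 'I_N} -> bool) :
  (forall N (kappa : {ffun vertex G -> 'I_N}),
     reflect (forall x y, adj x y -> kappa x <> kappa y) (P N kappa)) ->
  truncates (fun N => \sum_kappa (P N kappa)%:R * \prod_v malg_var (kappa v))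
    (chromatic_symmetric G).
Proof.
move=> PP N m ltmN; rewrite /chromatic_symmetric raddf_sum /=.
pose h (kappa : {ffun vertex G -> 'I_N}) := [ffun v => val (kappa v)].
have h_inj : injective h.
  move=> k l kl; apply/ffunP => v; apply/val_inj.
  by have := congr1 (fun f : {ffun vertex G -> nat} => f v) kl; rewrite !ffunE.
rewrite (fsbig_inj_fin h_inj) => [|k /= _ km].
  rewrite big_mkcond; apply: eq_bigr => k _ /=.
  have -> : `[< proper_coloring (h k) >] = P N k.
    apply/asboolP/PP => kP x y xy; have := kP x y xy; rewrite !ffunE.
      by move=> + kxy; rewrite kxy.
    by move=> + /val_inj.
  case: (P N k); last by rewrite mul0r mcoeff0.
  rewrite mul1r /malg_var -big_enum /= prod_malg_var mcoeffU1; congr (_ == _)%:R.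
  by apply: eq_bigr => v _; rewrite ffunE.
have {}km : monomial_prod (enum (vertex G)) k = m
  by apply/eqP; apply: contraNT km => /negPf ->.
have ltk v : (k v < N)%N.
  by apply: ltmN; rewrite -km monomial_prod_supp ?mem_enum.
exists [ffun v => Ordinal (ltk v)]; apply/ffunP => v.
by rewrite !ffunE.
Qed.

End Truncation.

(** * From uniform polynomial identities to e-positivity *)

Section EPositive.

Lemma partition_of_seqP (s : seq nat) :
  sorted geq (sort geq [seq k <- s | 0 < k]%N)
  && all (leq 1) (sort geq [seq k <- s | 0 < k]%N).
Proof.
rewrite sort_sorted; last by move=> m n; apply: leq_total.
by rewrite all_sort filter_all.
Qed.

(** Zeros may be dropped because e_0 = 1. *)
Definition partition_of_seq s := IntPartition (partition_of_seqP s).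

Lemma prod_partition_of_seq (R : comNzRingType) (e : nat -> R) s : e 0%N = 1 ->
  \prod_(k <- partition_of_seq s) e k = \prod_(k <- s) e k.
Proof.
move=> e0; rewrite (perm_big _ (permEl (perm_sort _ _))) big_filter.
by rewrite [RHS](bigID (fun k => 0 < k)%N) /= [X in _ * X]big1 ?mulr1 // => -[|].
Qed.

(** Every monomial lies below some N, and the list given by [epos] does not depend on N; its
    multiplicities are the nonnegative coefficients. *)
Lemma e_positive_truncates (G : sgraph)
    (f : (nat -> {malg int[monomial]}) -> {malg int[monomial]}) :
  epos f ->
  truncates (fun N => f (elem_series (@malg_var N))) (chromatic_symmetric G) ->
  e_positive G.
Proof.
move=> [s fs] Gf; pose r := [seq partition_of_seq la | la <- s].
pose c : {fsfun int_partition -> int with 0} :=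
  [fsfun la in [fset la | la in r]%fset => (count_mem la r)%:Z].
have cE la : c la = (count_mem la r)%:Z.
  rewrite fsfunE !inE /=; case: ifP => // /negbT/count_memPn -> //.
exists c => [m|la]; last by rewrite cE.
have [N ltmN] : exists N, monomial_below N m.
  exists (\max_(i <- enum_fset (finsupp (m : {cmonom nat}))) i).+1 => i im.
  by rewrite ltnS (big_rem i) //= leq_maxl.
rewrite (Gf N m ltmN) fs ?elem0 // raddf_sum /=.
transitivity (\sum_(la <- r) elementary_part la m).
  rewrite big_map; apply: eq_bigr => la _.
  by rewrite (truncates_elementary_part _ ltmN) prod_partition_of_seq ?elem0.
rewrite -big_undup_iterop_count /=.
transitivity (\sum_(la <- undup r) c la * elementary_part la m).
  by apply: eq_bigr => la _; rewrite cE -natz mulr_natl.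
apply: perm_big; apply: uniq_perm => [||la]; rewrite ?undup_uniq ?fset_uniq //.
by rewrite mem_undup mem_finsupp cE eqz_nat -lt0n -has_count has_pred1.
Qed.

End EPositive.

Lemma theta_properP (I : finType) a b c
    (kappa : {ffun theta_vertex a.+1 b.+1 c.+1 -> I}) :
  reflect (forall x y, @theta_adj a.+1 b.+1 c.+1 x y -> kappa x <> kappa y)
    (theta_proper kappa).
Proof.
apply: (iffP 'forall_forallP) => [kP x y|kP i k].
  move=> /existsP[i /existsP[k /orP[]/andP[/eqP -> /eqP ->]]];
    [exact/eqP/kP|exact/nesym/eqP/kP].
by apply/eqP/kP/existsP; exists i; apply/existsP; exists k; rewrite !eqxx.
Qed.

Local Close Scope ring_scope.

Theorem theorem1p2 (a b : nat) (ha : 1 <= a) (hb : 1 <= b)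
    (hab : ~ (a = 1 /\ b = 1)) :
  e_positive (clock_graph a b).
Proof.
case: a b ha hb {hab} => [|a] [|b] // _ _.
apply: (e_positive_truncates (clock_poly_pos _ a b)) => N m ltmN.
(* [theta_sum] is indexed by numbers of internal vertices, so the path of length 2 has index 1; it
   stands in the middle in [theta_clockE] and last in [clock_graph]. *)
rewrite -theta_clockE theta_sumAC -theta_colourings.
exact: (@truncates_chromatic (clock_graph a.+1 b.+1)
  (fun N kappa => theta_proper kappa) (fun N kappa => theta_properP kappa) N m ltmN).
Qed.
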